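(* Every $(K_3, K_4)$-co-critical graph on $n\ge 9$ vertices has minimum degree at least seven. Moreover, the bound is sharp: for every $n\ge 9$ there exists a $(K_3,K_4)$-co-critical graph on $n$ vertices with minimum degree exactly seven.
   Context: All graphs are finite, simple and undirected. For graphs $G, H_1, H_2$, write $G\rightarrow (H_1,H_2)$ if every 2-coloring of the edges of $G$ with colors red and blue contains a red copy of $H_1$ or a blue copy of $H_2$ (as subgraphs). A non-complete graph $G$ is $(H_1,H_2)$-co-critical if $G\not\rightarrow(H_1,H_2)$ but $G+e\rightarrow(H_1,H_2)$ for every edge $e$ of the complement $\overline{G}$, where $G+e$ is the graph obtained from $G$ by adding $e$. *)

(* Defs.v *)
From mathcomp Require Import all_boot.

Set Implicit Arguments.
Unset Strict Implicit.
Unset Printing Implicit Defensive.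

Record sgraph := SGraph {
  svertex :> finType;
  sedge : rel svertex;
  sedge_sym : symmetric sedge;
  sedge_irr : irreflexive sedge
}.

Notation "x -- y" := (sedge x y) (at level 30, no associativity).

Definition complete_rel (n : nat) : rel 'I_n := fun x y => x != y.

Lemma complete_sym n : symmetric (@complete_rel n).
Proof. by move=> x y; rewrite /complete_rel eq_sym. Qed.

Lemma complete_irr n : irreflexive (@complete_rel n).
Proof. by move=> x; rewrite /complete_rel eqxx. Qed.

Definition complete (n : nat) : sgraph :=
  SGraph (@complete_sym n) (@complete_irr n).

Notation "''K_' n" := (complete n) (at level 8, n at level 2, format "''K_' n").

Definition is_complete (G : sgraph) : Prop :=
  forall x y : G, x != y -> x -- y.

(* A copy of H is a subgraph, not necessarily an induced one. *)
Definition has_copy (H G : sgraph) : Prop :=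
  exists f : H -> G, injective f /\ forall x y : H, x -- y -> f x -- f y.

(* An edge is coloured through its set of two endpoints; the values of c on
   sets that are not edges are irrelevant. *)
Definition color_rel (G : sgraph) (c : {set G} -> bool) (b : bool) : rel G :=
  fun x y => (x -- y) && (c [set x; y] == b).

Lemma color_sym G c b : symmetric (@color_rel G c b).
Proof. by move=> x y; rewrite /color_rel sedge_sym setUC. Qed.

Lemma color_irr G c b : irreflexive (@color_rel G c b).
Proof. by move=> x; rewrite /color_rel sedge_irr. Qed.

Definition color_graph (G : sgraph) (c : {set G} -> bool) (b : bool) : sgraph :=
  SGraph (@color_sym G c b) (@color_irr G c b).

(* true is red, false is blue. *)
Definition arrows (G H1 H2 : sgraph) : Prop :=
  forall c : {set G} -> bool,
    has_copy H1 (color_graph c true) \/ has_copy H2 (color_graph c false).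

Definition add_edge_rel (G : sgraph) (x y : G) : rel G :=
  fun u v => (u -- v) || (u != v) && ([set u; v] == [set x; y]).

Lemma add_edge_sym G x y : symmetric (@add_edge_rel G x y).
Proof.
by move=> u v; rewrite /add_edge_rel sedge_sym eq_sym [[set u; v]]setUC.
Qed.

Lemma add_edge_irr G x y : irreflexive (@add_edge_rel G x y).
Proof. by move=> u; rewrite /add_edge_rel sedge_irr eqxx. Qed.

Definition add_edge (G : sgraph) (x y : G) : sgraph :=
  SGraph (@add_edge_sym G x y) (@add_edge_irr G x y).

Definition co_critical (H1 H2 G : sgraph) : Prop :=
  [/\ ~ is_complete G,
      ~ arrows G H1 H2 &
      forall x y : G, x != y -> ~~ (x -- y) -> arrows (add_edge x y) H1 H2].

Definition degree (G : sgraph) (x : G) : nat := #|[set y : G | x -- y]|.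

(* Every degree is less than #|G|, so the initial value #|G| is never attained
   when G has a vertex. *)
Definition min_degree (G : sgraph) : nat :=
  \big[minn/#|G|]_(x : G) degree x.

(* Main.v *)
Require Import Defs.
From mathcomp Require Import all_boot.

Set Implicit Arguments.
Unset Strict Implicit.
Unset Printing Implicit Defensive.

(* A graph with a proper 8-colouring does not arrow (K_3, K_4): pull back the
   colouring of K_8 whose red edges form the Wagner graph. So it suffices to
   show that if x has degree at most 6, then G + xy is 8-colourable for some
   non-neighbour y of x. Let N be the neighbourhood of x and Y the set of its
   non-neighbours. Colouring N injectively with six colours leaves two new
   ones; a vertex of Y may also reuse the colour of a vertex of N to which it
   is not adjacent, and x takes a new colour.

   Fix a colouring of G without red K_3 and blue K_4. If R, a subset of N, spans
   no red edge and N \ R spans no blue triangle, then the edges from x may be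
   recoloured red on R and blue on N \ R. As G + xy arrows, whichever the colour
   of xy, each y in Y then has a red neighbour r in R and is joined in blue to
   both ends of a blue edge pq of N \ R. Vertices of Y with the same r, p, q are
   pairwise nonadjacent, so Y is a union of few independent classes. Moreover y
   is not joined in red to a red neighbour of r, nor in blue to a vertex that
   forms a blue triangle with p and q; this gives nonadjacencies between Y and
   N, which allow colours of N to be reused. The cases are those of the least
   possible size of R: one, two, or at least three.

   For sharpness, the join of K_7 with an independent set maps onto K_8, and any
   new edge creates a K_9, which arrows (K_3, K_4) because R(3,4) = 9. *)

(** * Graphs with a proper 8-colouring *)

Lemma has_copy3P (G : sgraph) :
  has_copy 'K_3 G <-> exists a b c : G, [/\ a -- b, a -- c & b -- c].
Proof.
split=> [[f [_ fE]]|[a [b [c [ab ac bc]]]]].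
  exists (f (inord 0)), (f (inord 1)), (f (inord 2)).
  by split; apply: fE; rewrite /= /complete_rel -val_eqE /= !inordK.
have fE (i j : 'I_3) : i != j -> tnth [tuple a; b; c] i -- tnth [tuple a; b; c] j.
  case: i j => [[|[|[|i]]] //= ?] [[|[|[|j]]] //= ?] //= _;
    by rewrite !(tnth_nth a) //= sedge_sym.
exists (tnth [tuple a; b; c]); split=> // i j fij.
by apply/eqP/negPn/negP => /fE; rewrite fij sedge_irr.
Qed.

Lemma has_copy4P (G : sgraph) :
  has_copy 'K_4 G <-> exists a b c d : G,
    [/\ a -- b, a -- c & a -- d] /\ [/\ b -- c, b -- d & c -- d].
Proof.
split=> [[f [_ fE]]|[a [b [c [d [[ab ac ad] [bc bd cd]]]]]]].
  exists (f (inord 0)), (f (inord 1)), (f (inord 2)), (f (inord 3)).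
  by split; split; apply: fE; rewrite /= /complete_rel -val_eqE /= !inordK.
set t := [tuple a; b; c; d].
have fE (i j : 'I_4) : i != j -> tnth t i -- tnth t j.
  case: i j => [[|[|[|[|i]]]] //= ?] [[|[|[|[|j]]]] //= ?] //= _;
    by rewrite !(tnth_nth a) //= sedge_sym.
exists (tnth t); split=> // i j fij.
by apply/eqP/negPn/negP => /fE; rewrite fij sedge_irr.
Qed.

(* The Wagner graph. *)
Definition wagner (i j : nat) : bool :=
  [|| i.+1 %% 8 == j, j.+1 %% 8 == i, i + 4 == j | j + 4 == i].

Lemma wagner_sym i j : wagner i j = wagner j i.
Proof. by rewrite /wagner; do 4 case: eqP. Qed.

Lemma wagner_irr (i : 'I_8) : wagner i i = false.
Proof. by move: i => [] [|[|[|[|[|[|[|[|i]]]]]]]]. Qed.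

Lemma wagner_triangle_free (i j k : 'I_8) :
  wagner i j -> wagner i k -> wagner j k -> False.
Proof.
have: all (fun a => all (fun b => all (fun c =>
  ~~ [&& wagner a b, wagner a c & wagner b c]) (iota 0 8)) (iota 0 8)) (iota 0 8) by [].
have mem (l : 'I_8) : nat_of_ord l \in iota 0 8 by rewrite mem_iota ltn_ord.
move/allP/(_ i (mem i))/allP/(_ j (mem j))/allP/(_ k (mem k)).
by move=> h ij ik jk; rewrite ij ik jk in h.
Qed.

(** Checked on all quadruples. Together with triangle-freeness this is the colouring behind R(3,4) >
    8. *)
Lemma wagner_independence (i j k l : 'I_8) :
  uniq [:: i; j; k; l] ->
  [|| wagner i j, wagner i k, wagner i l, wagner j k, wagner j l | wagner k l].
Proof.
have: all (fun a => all (fun b => all (fun c => all (fun d =>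
  uniq [:: a; b; c; d] ==>
  [|| wagner a b, wagner a c, wagner a d, wagner b c, wagner b d | wagner c d])
  (iota 0 8)) (iota 0 8)) (iota 0 8)) (iota 0 8) by vm_compute.
have mem (m : 'I_8) : nat_of_ord m \in iota 0 8 by rewrite mem_iota ltn_ord.
move/allP/(_ i (mem i))/allP/(_ j (mem j))/allP/(_ k (mem k))/allP/(_ l (mem l)).
by move/implyP=> h; rewrite -(map_inj_uniq val_inj).
Qed.

Lemma colorable8_not_arrows (G : sgraph) (f : G -> 'I_8) :
  (forall u v : G, u -- v -> f u != f v) -> ~ arrows G 'K_3 'K_4.
Proof.
(* Colours live on vertex sets, so the pulled-back colour is stated existentially. On a pair it
   reduces to [wagner (f u) (f v)], because [wagner] is symmetric and irreflexive. *)
move=> fE; pose c (A : {set G}) := [exists u in A, exists v in A, wagner (f u) (f v)].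
have cE u v : c [set u; v] = wagner (f u) (f v).
  apply/existsP/idP => [[a /andP[aA /existsP[b /andP[bA]]]]|w].
    by move: aA bA; rewrite !inE => /orP[]/eqP-> /orP[]/eqP->;
      rewrite ?wagner_irr // wagner_sym.
  by exists u; rewrite !inE eqxx /=; apply/existsP; exists v; rewrite !inE eqxx orbT.
move=> /(_ c)[/has_copy3P[u [v [w []]]]|/has_copy4P[u [v [w [z [[] + + + []]]]]]];
  rewrite /= /color_rel !cE ?eqb_id ?eqbF_neg.
  by move=> /andP[_ a] /andP[_ b] /andP[_ d]; apply: wagner_triangle_free a b d.
move=> /andP[uv nuv] /andP[uw nuw] /andP[uz nuz] /andP[vw nvw] /andP[vz nvz] /andP[wz nwz].
have := @wagner_independence (f u) (f v) (f w) (f z).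
rewrite /= !inE !negb_or !fE //= (negPf nuv) (negPf nuw) (negPf nuz).
by rewrite (negPf nvw) (negPf nvz) (negPf nwz) => /(_ isT).
Qed.

(** * Colouring the non-neighbours of a vertex of small degree *)

Section Extension.

Variables (T : finType) (red blue : rel T).
Hypotheses (redC : symmetric red) (blueC : symmetric blue).
Hypotheses (red_irr : irreflexive red) (blue_irr : irreflexive blue).
Hypothesis red_blue : forall u v, red u v -> ~~ blue u v.
Hypothesis red_triangle_free : forall u v w,
  red u v -> red u w -> red v w -> False.
Hypothesis blue_K4_free : forall u v w z,
  blue u v -> blue u w -> blue u z -> blue v w -> blue v z -> blue w z -> False.

Variables N Y : {set T}.
Hypothesis card_N : #|N| <= 6.
Hypothesis Y_neq0 : Y != set0.

(** * Independent classes and colour lists for the non-neighbours *)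

Definition independent (P : pred T) : Prop :=
  forall y z, P y -> P z -> ~~ red y z && ~~ blue y z.

Definition avoids (k : bool + T) (y : T) : bool :=
  if k is inr h then ~~ red y h && ~~ blue y h else true.

(* The colour [inr h] is that of the vertex [h] of [N]; the colours [inl b] are
   the two that do not occur on [N]. *)
Definition palette_colorable : Prop :=
  exists k : T -> bool + T,
    (forall y, y \in Y -> avoids (k y) y /\ forall h, k y = inr h -> h \in N) /\
    (forall y z, y \in Y -> z \in Y -> red y z || blue y z -> k y != k z).

(** Each entry of [L] pairs a colour with an independent class. Every [y] takes the first entry
    whose class contains it and whose colour it may use. As the colours are distinct, equal colours
    mean the same entry, hence a common independent class. *)
Lemma palette_colorableI (L : seq ((bool + T) * pred T)) :
  uniq (map fst L) ->
  all (fun c => if c.1 is inr h then h \in N else true) L ->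
  foldr (fun c Q => independent c.2 /\ Q) True L ->
  (forall y, y \in Y -> has (fun c => c.2 y && avoids c.1 y) L) ->
  palette_colorable.
Proof.
move=> uL NL indL hasL.
pose c0 : (bool + T) * pred T := (inl true, xpred0).
pose i y := find (fun c : (bool + T) * pred T => c.2 y && avoids c.1 y) L.
have iL y : y \in Y -> i y < size L by move=> /hasL; rewrite has_find.
have iP y : y \in Y -> (nth c0 L (i y)).2 y && avoids (nth c0 L (i y)).1 y.
  by move=> /hasL yL; rewrite (nth_find c0 yL).
exists (fun y => (nth c0 L (i y)).1); split=> [y yY|y z yY zY].
  have /andP[_ av] := iP y yY; split=> // h kh.
  by have /(all_nthP c0)/(_ _ (iL y yY)) := NL; rewrite kh.
have /andP[yP _] := iP y yY; have /andP[zP _] := iP z zY.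
apply: contraL => /eqP eqk.
have eqi : i y = i z.
  apply/eqP; rewrite -(nth_uniq (inl true) _ _ uL) ?size_map ?iL //.
  by rewrite !(nth_map c0) ?iL // eqk.
rewrite negb_or; move: yP zP; rewrite eqi => yP zP.
have indN M j : foldr (fun c Q => independent c.2 /\ Q) True M -> j < size M ->
  independent (nth c0 M j).2 by elim: M j => // c M IH [|j] /= [? ?] // /IH; apply.
exact: indN indL (iL z zY) _ _ yP zP.
Qed.

Definition joined (r p q : T) : pred T :=
  fun y => [&& red y r, blue p q, blue y p & blue y q].

(** A red edge inside the class would close a red triangle at [r], a blue one a blue K_4 with [p]
    and [q]. *)
Lemma independent_joined r p q : independent (joined r p q).
Proof.
move=> y z /and4P[yr pq yp yq] /and4P[zr _ zp zq]; apply/andP; split; apply/negP=> yz.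
  exact: red_triangle_free yz yr zr.
exact: blue_K4_free yz yp yq zp zq pq.
Qed.

(** * Red and blue sides of the neighbourhood *)

Definition red_free (R : {set T}) : bool :=
  [forall u in R, forall v in R, ~~ red u v].

Definition blue_triangle_free (B : {set T}) : bool :=
  [forall u in B, forall v in B, forall w in B, ~~ [&& blue u v, blue u w & blue v w]].

Lemma red_freeP (R : {set T}) :
  reflect (forall u v, u \in R -> v \in R -> ~~ red u v) (red_free R).
Proof.
apply: (iffP forall_inP) => [h u v uR vR|h u uR].
  by have /forall_inP := h u uR; apply.
by apply/forall_inP => v vR; apply: h.
Qed.

Lemma blue_triangle_freeP (B : {set T}) :
  reflect (forall u v w, u \in B -> v \in B -> w \in B ->
             blue u v -> blue u w -> blue v w -> False)
          (blue_triangle_free B).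
Proof.
apply: (iffP forall_inP) => [h u v w uB vB wB uv uw vw|h u uB].
  by have /forall_inP/(_ v vB)/forall_inP/(_ w wB) := h u uB; rewrite uv uw vw.
apply/forall_inP => v vB; apply/forall_inP => w wB.
by apply/negP => /and3P[]; apply: h.
Qed.

Lemma blue_triangle_freePn (B : {set T}) : ~~ blue_triangle_free B ->
  exists u v w, [/\ u \in B, v \in B & w \in B] /\ [/\ blue u v, blue u w & blue v w].
Proof.
case/forall_inPn => u uB /forall_inPn[v vB /forall_inPn[w wB]].
by move/negPn/and3P => [uv uw vw]; exists u, v, w.
Qed.

Lemma blue_triangle_freeS (A B : {set T}) :
  A \subset B -> blue_triangle_free B -> blue_triangle_free A.
Proof.
move=> /subsetP AB /blue_triangle_freeP h; apply/blue_triangle_freeP => u v w uA vA wA.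
by apply: h; apply: AB.
Qed.

(* A new vertex with neighbourhood [N] can be joined in red to [R] and in blue to
   the rest of [N]. *)
Definition extends (R : {set T}) : bool :=
  [&& R \subset N, red_free R & blue_triangle_free (N :\: R)].

Lemma extendsS (R R' : {set T}) :
  extends R -> R \subset R' -> R' \subset N -> red_free R' -> extends R'.
Proof.
case/and3P=> _ _ h RR' R'N r'; apply/and3P; split=> //.
by apply: blue_triangle_freeS h; apply: setDS.
Qed.

(** The only form in which arrowing of G + xy enters this section; [recolor_extends_hit] supplies
    it. *)
Hypothesis extends_hit : forall R y, extends R -> y \in Y ->
  (exists2 r, r \in R & red y r) /\
  exists p q, [/\ p \in N :\: R, q \in N :\: R & [&& blue p q, blue y p & blue y q]].

(** A truth table over the colours in the goal: once the relevant exclusions are among the premises,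
    the remaining argument is propositional. *)
Ltac color_cases := repeat (match goal with
  | |- context [red ?u ?v] => case: (red u v)
  | |- context [blue ?u ?v] => case: (blue u v)
  end => //=).

Lemma red_excl y r b : red y r -> red r b -> ~~ red y b.
Proof. by move=> yr rb; apply/negP=> yb; apply: red_triangle_free yr yb rb. Qed.

Lemma blue_excl y r p q :
  blue p q -> blue r p -> blue r q -> blue y p && blue y q -> ~~ blue y r.
Proof.
move=> pq rp rq /andP[yp yq]; apply/negP=> yr.
exact: blue_K4_free yr yp yq rp rq pq.
Qed.

(** Some pair among three vertices is not blue; taking it as [u], [w] places all blue edges on the
    path [u v w]. Smaller sets are covered by repeating a vertex. *)
Lemma blue_triangle_free3 (B : {set T}) : blue_triangle_free B -> B != set0 -> #|B| <= 3 ->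
  exists u v w, [/\ u \in B, v \in B & w \in B] /\
    {subset B <= [:: u; v; w]} /\ ~~ blue u w.
Proof.
move=> /blue_triangle_freeP tf; rewrite -card_gt0 => B0 B3.
have [u [v [w [uB vB wB sB]]]] : exists u v w,
    [/\ u \in B, v \in B, w \in B & {subset B <= [:: u; v; w]}].
  have mE z : (z \in enum B) = (z \in B) by rewrite mem_enum.
  move: B0 B3 mE; rewrite cardE; case: (enum B) => [|a [|b [|c []]]] //= _ _ mE.
  - by exists a, a, a; split; rewrite -?mE ?inE ?eqxx // => z; rewrite -mE !inE => ->.
  - exists a, b, b; split; rewrite -?mE ?inE ?eqxx ?orbT // => z.
    by rewrite -mE !inE => /orP[]->; rewrite ?orbT.
  by exists a, b, c; split; rewrite -?mE ?inE ?eqxx ?orbT // => z; rewrite -mE.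
case uw: (blue u w); last by exists u, v, w; rewrite uw.
case uv: (blue u v).
  case vw: (blue v w); first by case: (tf u v w).
  exists v, u, w; rewrite vw; split=> //; split=> // z /sB; rewrite !inE.
  by move=> /or3P[]->; rewrite ?orbT.
exists u, w, v; rewrite uv; split=> //; split=> // z /sB; rewrite !inE.
by move=> /or3P[]->; rewrite ?orbT.
Qed.

Lemma edge3 u v w y p q : p \in [:: u; v; w] -> q \in [:: u; v; w] -> ~~ blue u w ->
  [&& blue p q, blue y p & blue y q] ->
  [&& blue u v, blue y u & blue y v] || [&& blue v w, blue y v & blue y w].
Proof.
rewrite !inE => /or3P[]/eqP-> /or3P[]/eqP->; rewrite ?blue_irr //= => uw;
  rewrite ?(blueC v u) ?(blueC w u) ?(blueC w v); move: uw; color_cases.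
Qed.

Lemma extends3_hit (R : {set T}) : extends R -> #|N :\: R| <= 3 ->
  exists u v w, [/\ u \in N :\: R, v \in N :\: R & w \in N :\: R] /\
   [/\ {subset N :\: R <= [:: u; v; w]}, ~~ blue u w &
    forall y, y \in Y -> [&& blue u v, blue y u & blue y v] || [&& blue v w, blue y v & blue y w]].
Proof.
move=> cR B3; have [_ _ tf] := and3P cR.
have B0 : N :\: R != set0.
  have [y yY] := set0Pn _ Y_neq0.
  by have [_ [p [q [pB _ _]]]] := extends_hit cR yY; apply/set0Pn; exists p.
have [u [v [w [uvw [sB uw]]]]] := blue_triangle_free3 tf B0 B3.
exists u, v, w; split=> //; split=> // y yY.
have [_ [p [q [/sB pB /sB qB e]]]] := extends_hit cR yY.
exact: edge3 pB qB uw e.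
Qed.

(** * A vertex joined in red to every non-neighbour *)

Lemma dominated_small (R : {set T}) r : extends R -> #|N :\: R| <= 3 ->
  (forall y, y \in Y -> red y r) -> palette_colorable.
Proof.
move=> cR B3 yr; have [u [v [w [_ [_ _ h]]]]] := extends3_hit cR B3.
apply: (@palette_colorableI [:: (inl true, joined r u v); (inl false, joined r v w)]) => //.
  by do !split; apply: independent_joined.
by move=> y yY; move: (h y yY) (yr y yY); rewrite /joined /=; color_cases.
Qed.

(** The relevant blue edges lie on the cycle [a b c z]. If [ab] is blue, the classes of [bc] and
    [za] reuse the colours of [a] and [b]: [y] is not red to either, being red to [r], and if it is
    blue to the vertex whose colour it would reuse, it already belongs to the class of [ab].
    Otherwise at most three classes occur and at most one colour is reused. *)
Lemma dominated_cycle r a b c z :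
  (forall y, y \in Y -> red y r) -> red r a -> red r b -> a \in N -> b \in N -> a != b ->
  (forall y, y \in Y -> [|| [&& blue a b, blue y a & blue y b],
     [&& blue b c, blue y b & blue y c], [&& blue c z, blue y c & blue y z] |
     [&& blue z a, blue y z & blue y a]]) -> palette_colorable.
Proof.
move=> yr ra rb aN bN ab h.
have joinedY := independent_joined.
case eab: (blue a b); last case eza: (blue z a).
- apply: (@palette_colorableI [:: (inl true, joined r a b); (inl false, joined r c z);
    (inr a, joined r b c); (inr b, joined r z a)]).
  + by rewrite /= !inE /eq_op /= ab.
  + by rewrite /= aN bN.
  + by do !split; apply: joinedY.
  move=> y yY; move: eab (h y yY) (yr y yY) (red_excl (yr y yY) ra) (red_excl (yr y yY) rb).
  by rewrite /joined /=; color_cases.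
- apply: (@palette_colorableI [:: (inl true, joined r b c); (inl false, joined r z a);
    (inr a, joined r c z)]) => //; first by rewrite /= aN.
  + by do !split; apply: joinedY.
  move=> y yY; move: eab eza (h y yY) (yr y yY) (red_excl (yr y yY) ra).
  by rewrite /joined /=; color_cases.
apply: (@palette_colorableI [:: (inl true, joined r b c); (inl false, joined r c z)]) => //.
  by do !split; apply: joinedY.
move=> y yY; move: eab eza (h y yY) (yr y yY).
by rewrite /joined /=; color_cases.
Qed.

(** The relevant blue edges form a star at [z]. The class of [zc] reuses the colour of [a], since a
    member blue to [a] also lies in the class of [za]. *)
Lemma dominated_star r z a b c :
  (forall y, y \in Y -> red y r) -> red r a -> a \in N ->
  (forall y, y \in Y -> [|| [&& blue z a, blue y z & blue y a],
     [&& blue z b, blue y z & blue y b] | [&& blue z c, blue y z & blue y c]]) ->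
  palette_colorable.
Proof.
move=> yr ra aN h.
have joinedY := independent_joined; case eza: (blue z a).
  apply: (@palette_colorableI [:: (inl true, joined r z a); (inl false, joined r z b);
    (inr a, joined r z c)]) => //; first by rewrite /= aN.
    by do !split; apply: joinedY.
  move=> y yY; move: eza (h y yY) (yr y yY) (red_excl (yr y yY) ra).
  by rewrite /joined /=; color_cases.
apply: (@palette_colorableI [:: (inl true, joined r z b); (inl false, joined r z c)]) => //.
  by do !split; apply: joinedY.
by move=> y yY; move: eza (h y yY) (yr y yY); rewrite /joined /=; color_cases.
Qed.

Lemma dominated4 r a b c z (R : {set T}) : extends R ->
  (forall y, y \in Y -> red y r) -> red r a -> red r b -> red r c ->
  uniq [:: a; b; c; z] -> N :\: R =i [:: a; b; c; z] -> palette_colorable.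
Proof.
move=> cR yr ra rb rc abcz BE; have [_ _ /blue_triangle_freeP tf] := and3P cR.
have BN u : u \in [:: a; b; c; z] -> u \in N by rewrite -BE => /setDP[].
have /and4P[aN bN cN zN] : [&& a \in N, b \in N, c \in N & z \in N].
  by rewrite !BN // !inE eqxx ?orbT.
have tfb u v w : u \in [:: a; b; c; z] -> v \in [:: a; b; c; z] -> w \in [:: a; b; c; z] ->
    ~~ [&& blue u v, blue u w & blue v w].
  by move=> uB vB wB; apply/negP => /and3P[]; apply: tf; rewrite BE.
have /and4P[tabc tabz tacz tbcz] : [&& ~~ [&& blue a b, blue a c & blue b c],
    ~~ [&& blue a b, blue a z & blue b z], ~~ [&& blue a c, blue a z & blue c z] &
    ~~ [&& blue b c, blue b z & blue c z]].
  by rewrite !tfb // !inE eqxx ?orbT.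
have hY y : y \in Y -> [|| [&& blue a b, blue y a & blue y b],
    [&& blue a c, blue y a & blue y c], [&& blue a z, blue y a & blue y z],
    [&& blue b c, blue y b & blue y c], [&& blue b z, blue y b & blue y z] |
    [&& blue c z, blue y c & blue y z]].
  move=> yY; have [_ [p [q []]]] := extends_hit cR yY; rewrite !BE !inE.
  by move=> /or4P[]/eqP-> /or4P[]/eqP->; rewrite ?blue_irr // ?(blueC b a) ?(blueC c a)
    ?(blueC z a) ?(blueC c b) ?(blueC z b) ?(blueC z c); color_cases.
have /and3P[ab ac bc] : [&& a != b, a != c & b != c].
  by move: abcz; rewrite /= !inE !negb_or -!andbA => /and4P[-> -> _ /andP[->]].
(* A triangle-free graph on four vertices is contained in a 4-cycle or in a star. The first three
   alternatives are the 4-cycles, the last the four stars. The vertices whose colours are reused are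
   always chosen among [a], [b], [c], which are red to [r]. *)
have /or4P[/andP[e1 e2]|/andP[e1 e2]|/andP[e1 e2]|] :
  [|| ~~ blue a c && ~~ blue b z, ~~ blue a b && ~~ blue c z, ~~ blue b c && ~~ blue a z |
   [|| [&& ~~ blue a b, ~~ blue a c & ~~ blue b c], [&& ~~ blue b c, ~~ blue b z & ~~ blue c z],
    [&& ~~ blue a c, ~~ blue a z & ~~ blue c z] | [&& ~~ blue a b, ~~ blue a z & ~~ blue b z]]].
  by move: tabc tabz tacz tbcz; color_cases.
- apply: (@dominated_cycle r a b c z) => // y yY.
  by move: e1 e2 (hY y yY); rewrite (blueC z a); color_cases.
- apply: (@dominated_cycle r a c b z) => // y yY.
  by move: e1 e2 (hY y yY); rewrite (blueC z a) (blueC c b); color_cases.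
- apply: (@dominated_cycle r b a c z) => // [|y yY]; first by rewrite eq_sym.
  by move: e1 e2 (hY y yY); rewrite (blueC z b) (blueC b a); color_cases.
case/or4P => /and3P[e1 e2 e3].
- apply: (@dominated_star r z a b c) => // y yY.
  by move: e1 e2 e3 (hY y yY); rewrite !(blueC z); color_cases.
- apply: (@dominated_star r a b c z) => // y yY.
  by move: e1 e2 e3 (hY y yY); color_cases.
- apply: (@dominated_star r b a c z) => // y yY.
  by move: e1 e2 e3 (hY y yY); rewrite (blueC b a); color_cases.
apply: (@dominated_star r c a b z) => // y yY.
by move: e1 e2 e3 (hY y yY); rewrite (blueC c a) (blueC c b); color_cases.
Qed.

Lemma card_extendsC (R : {set T}) : extends R -> #|N :\: R| <= 6 - #|R|.
Proof. by case/and3P=> RN _ _; rewrite cardsDS // leq_sub2r. Qed.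

Lemma red_free2 u v : ~~ red u v -> red_free [set u; v].
Proof.
move=> uv; apply/red_freeP => a b; rewrite !inE.
by move=> /orP[]/eqP-> /orP[]/eqP->; rewrite ?red_irr // redC.
Qed.

Lemma red_free3 u v w : ~~ red u v -> ~~ red u w -> ~~ red v w -> red_free [set u; v; w].
Proof.
move=> uv uw vw; apply/red_freeP => a b; rewrite !inE -!orbA.
by move=> /or3P[]/eqP-> /or3P[]/eqP->; rewrite ?red_irr // redC.
Qed.

Lemma cards3 (u v w : T) : u != v -> u != w -> v != w -> #|[set u; v; w]| = 3.
Proof.
by move=> uv uw vw; rewrite setUC cardsU1 !inE negb_or cards2 uv eq_sym uw eq_sym vw.
Qed.

(* Here all of [Y] is joined in red to [r], so that only blue edges of [N] are
   needed to separate [Y] into independent classes. *)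
Lemma extends_set1 r : extends [set r] -> palette_colorable.
Proof.
move=> cr; have yr y : y \in Y -> red y r.
  by move=> yY; have [[s] /[!inE]/eqP->] := extends_hit cr yY.
have rN : r \in N by have /and3P[/subsetP sN _ _] := cr; apply: sN; rewrite inE.
(* If two further vertices can join [r] on the red side, at most three remain on the blue side. *)
have [|noQ] := boolP [exists s in N, exists t in N,
    [&& s != r, t != r, s != t, ~~ red r s, ~~ red r t & ~~ red s t]].
  case/exists_inP => s sN /exists_inP[t tN /and5P[sr tr st rs /andP[rt nst]]].
  have cR : extends [set r; s; t].
    apply: (extendsS cr); first by rewrite -setUA subsetUl.
      by apply/subsetP => u; rewrite !inE -orbA => /or3P[]/eqP->.
    exact: red_free3.
  apply: (dominated_small cR _ yr).
  by rewrite (leq_trans (card_extendsC cR)) // cards3 // eq_sym.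
have QP s t : s \in N -> t \in N -> s != r -> t != r -> s != t ->
    ~~ red r s -> ~~ red r t -> red s t.
  move=> sN tN sr tr st rs rt; apply/negPn/negP => nst; move/negP: noQ; apply.
  by apply/exists_inP; exists s => //; apply/exists_inP; exists t => //; apply/and5P; split => //; apply/andP.
(* Were [r] red to all of [N :\ r], that set would be a valid red side, leaving only [r] on the blue
   side and hence no blue edge there. *)
have [s [sN sr rs]] : exists s, [/\ s \in N, s != r & ~~ red r s].
  have [/exists_inP[s sN /andP[sr rs]]|no] := boolP [exists s in N, (s != r) && ~~ red r s].
    by exists s.
  have rP s : s \in N -> s != r -> red r s.
    move=> sN sr; apply/negPn/negP => rs; move/negP: no; apply.
    by apply/exists_inP; exists s => //; apply/andP.
  have [y yY] := set0Pn _ Y_neq0.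
  have cR : extends (N :\ r).
    apply/and3P; split; first exact: subD1set.
      apply/red_freeP => u v /setD1P[ur uN] /setD1P[vr vN].
      by apply: (@red_excl u r v); [rewrite redC|]; apply: rP.
    apply/blue_triangle_freeP => u v w; rewrite !inE !negb_and !negbK.
    move=> /andP[/orP[/eqP->|/negP//] _] /andP[/orP[/eqP->|/negP//] _].
    by rewrite blue_irr.
  have [_ [p [q []]]] := extends_hit cR yY; rewrite !inE !negb_and !negbK.
  move=> /andP[/orP[/eqP->|/negP//] _] /andP[/orP[/eqP->|/negP//] _].
  by rewrite blue_irr.
have cR : extends [set r; s].
  apply: (extendsS cr); first exact: subsetUl.
    by apply/subsetP => u; rewrite !inE => /orP[]/eqP->.
  exact: red_free2.
have [B3|B3] := leqP #|N :\: [set r; s]| 3; first exact: dominated_small cR B3 yr.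
have B4 : #|N :\: [set r; s]| = 4.
  by apply/eqP; rewrite eqn_leq B3 (leq_trans (card_extendsC cR)) // cards2 eq_sym sr.
(* Two vertices not red to [r] would form a red triangle with [s]. So [r] is red to at least three
   of the four remaining vertices, as [dominated4] requires. *)
have rP u v : u \in N :\: [set r; s] -> v \in N :\: [set r; s] -> u != v -> red r u || red r v.
  rewrite !inE !negb_or => /andP[/andP[ur us] uN] /andP[/andP[vr vs] vN] uv.
  apply/negPn/negP; rewrite negb_or => /andP[ru rv].
  by apply: (@red_triangle_free u v s); apply: QP.
move: B4 rP; rewrite cardE.
have mE u : (u \in enum (N :\: [set r; s])) = (u \in N :\: [set r; s]) by rewrite mem_enum.
have := enum_uniq (N :\: [set r; s]); move: mE.
case: (enum _) => [|a [|b [|c [|d []]]]] //= BE abcd _ rP.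
have {}rP u v : u \in [:: a; b; c; d] -> v \in [:: a; b; c; d] -> u != v -> red r u || red r v.
  by rewrite !BE; apply: rP.
have {}rP : [&& red r a || red r b, red r a || red r c, red r a || red r d,
    red r b || red r c, red r b || red r d & red r c || red r d].
  move: abcd; rewrite !inE !negb_or => /andP[/and3P[ab ac ad] /andP[/andP[bc bd] /andP[cd _]]].
  by rewrite !rP // !inE eqxx ?orbT.
have four u v w z : red r u -> red r v -> red r w -> perm_eq [:: a; b; c; d] [:: u; v; w; z] ->
    palette_colorable.
  move=> ru rv rw pm; apply: (dominated4 cR yr ru rv rw (z := z)).
    by rewrite -(perm_uniq pm).
  by move=> t; rewrite -BE (perm_mem pm).
move: rP; case ra: (red r a); case rb: (red r b); case rc: (red r c); case rd: (red r d) => //= _.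
- by apply: (four a b c d).
- by apply: (four a b c d).
- by apply: (four a b d c) => //; rewrite !perm_cons; apply/permP => p /=; rewrite addnCA.
- by apply: (four a c d b) => //; rewrite perm_cons; apply/permP => p /=; rewrite addnCA; congr addn; rewrite addnCA.
by apply: (four b c d a) => //; apply/permP => p /=; rewrite addnCA; congr addn; rewrite addnCA; congr addn; rewrite addnCA.
Qed.

(** * Smallest red side of size two *)

Lemma pair_edge r1 r2 p q : (forall y, y \in Y -> red y r1 || red y r2) ->
  (forall y, y \in Y -> [&& blue p q, blue y p & blue y q]) -> palette_colorable.
Proof.
move=> yr h; apply: (@palette_colorableI
  [:: (inl true, joined r1 p q); (inl false, joined r2 p q)]) => //.
  by do !split; apply: independent_joined.
by move=> y yY; move: (h y yY) (yr y yY); rewrite /joined /=; color_cases.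
Qed.

(** Two red neighbours and four blue edges give eight classes, matched with all eight colours. The
    class of [r2] and [cd] may use the colour of [r1]: its members are not blue to [r1], and those
    red to [r1] are in the first class. The class of [r1] and [bd] may use the colour of [a]: its
    members are not red to [a], and those blue to [a] are blue to both ends of [ab]. The others are
    symmetric. *)
Lemma pair_cross r1 r2 a b c d :
  {subset [:: r1; r2; a; b; c; d] <= N} -> uniq [:: r1; r2; a; b; c; d] ->
  red r1 a -> red r1 b -> red r2 c -> red r2 d ->
  blue r1 c -> blue r1 d -> blue r2 a -> blue r2 b -> blue a b -> blue c d ->
  (forall y, y \in Y -> red y r1 || red y r2) ->
  (forall y, y \in Y -> [|| blue y a && blue y b, blue y c && blue y d,
     [&& blue a c, blue y a & blue y c] | [&& blue b d, blue y b & blue y d]]) ->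
  palette_colorable.
Proof.
move=> sN uq r1a r1b r2c r2d r1c r1d r2a r2b ab cd yr h.
pose L : seq ((bool + T) * pred T) :=
  [:: (inl true, joined r1 c d); (inl false, joined r2 a b);
      (inr r1, joined r2 c d); (inr r2, joined r1 a b);
      (inr a, joined r1 b d); (inr b, joined r1 a c);
      (inr c, joined r2 b d); (inr d, joined r2 a c)].
apply: (@palette_colorableI L).
- have -> : map fst L = [:: inl true, inl false & map inr [:: r1; r2; a; b; c; d]] by [].
  rewrite 2!cons_uniq map_inj_uniq ?uq => [|? ? []//].
  by rewrite /= ?inE ?andbT.
- by rewrite /= !sN // !inE eqxx ?orbT.
- by do !split; apply: independent_joined.
move=> y yY.
have ex r e : red r e -> red y r ==> ~~ red y e.
  by move=> re; apply/implyP => yr'; apply: red_excl yr' re.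
have bx r p q : blue p q -> blue r p -> blue r q -> blue y p && blue y q ==> ~~ blue y r.
  by move=> pq rp rq; apply/implyP; apply: blue_excl pq rp rq.
move: (h y yY) (yr y yY) (ex _ _ r1a) (ex _ _ r1b) (ex _ _ r2c) (ex _ _ r2d)
  (bx _ _ _ cd r1c r1d) (bx _ _ _ ab r2a r2b).
by rewrite /L /joined /= ab cd; color_cases.
Qed.

(** A vertex blue to [u] and [v] is not blue to [r1]; if it is not red to [r1] either, it can take
    the colour of [r1]. Likewise for [vw] and [r2], so four colours serve the four classes. *)
Lemma pair_path_alternate r1 r2 u v w : r1 != r2 -> r1 \in N -> r2 \in N ->
  (forall y, y \in Y -> red y r1 || red y r2) ->
  (forall y, y \in Y ->
     [&& blue u v, blue y u & blue y v] || [&& blue v w, blue y v & blue y w]) ->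
  blue u v -> blue v w -> blue r1 u -> blue r1 v -> blue r2 v -> blue r2 w ->
  palette_colorable.
Proof.
move=> r12 r1N r2N yr h uv vw r1u r1v r2v r2w; apply: (@palette_colorableI
  [:: (inl true, joined r1 u v); (inr r1, joined r2 u v);
      (inl false, joined r2 v w); (inr r2, joined r1 v w)]).
- by rewrite /= !inE /eq_op /= r12.
- by rewrite /= r1N r2N.
- by do !split; apply: independent_joined.
move=> y yY; have /implyP b1 := @blue_excl y _ _ _ uv r1u r1v.
have /implyP b2 := @blue_excl y _ _ _ vw r2v r2w.
by move: b1 b2 (yr y yY) (h y yY); rewrite /joined /=; color_cases.
Qed.

(** Each [y] is red to two of [r1], [r2], [s], so any two of them have a common red neighbour. One
    class per blue edge then suffices. *)
Lemma pair_path_majority r1 r2 s u v w :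
  (forall y, y \in Y -> [&& red y r1 || red y r2, red y r1 || red y s & red y r2 || red y s]) ->
  (forall y, y \in Y ->
     [&& blue u v, blue y u & blue y v] || [&& blue v w, blue y v & blue y w]) ->
  palette_colorable.
Proof.
move=> yr h.
pose two y := [|| red y r1 && red y r2, red y r1 && red y s | red y r2 && red y s].
have ind p q : independent (fun y => two y && [&& blue p q, blue y p & blue y q]).
  move=> y z /andP[y2 /and3P[pq yp yq]] /andP[z2 /and3P[_ zp zq]]; apply/andP; split; apply/negP=> yz.
    have [t yt zt] : exists2 t, red y t & red z t.
      case/or3P: y2 => /andP[e1 e2]; case/or3P: z2 => /andP[e3 e4]; by [exists r1|exists r2|exists s].
    exact: red_triangle_free yz yt zt.
  exact: blue_K4_free yz yp yq zp zq pq.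
apply: (@palette_colorableI
  [:: (inl true, fun y => two y && [&& blue u v, blue y u & blue y v]);
      (inl false, fun y => two y && [&& blue v w, blue y v & blue y w])]) => //.
  by do !split; apply: ind.
by move=> y yY; move: (yr y yY) (h y yY); rewrite /two /=; color_cases.
Qed.

(** The critical class is that of [r1] and [uv]. A member not red to [r2] is red to both [r1] and
    [s], one of which is red to [w]; hence it is not red to [w]. If it is blue to [w], it is served
    by the classes of [vw]; otherwise it takes the colour of [w]. *)
Lemma pair_path_one_sided r1 r2 s u v w : r2 \in N -> w \in N ->
  (forall y, y \in Y -> (red y r1 || red y r2) && (red y r2 || red y s)) ->
  (forall y, y \in Y ->
     [&& blue u v, blue y u & blue y v] || [&& blue v w, blue y v & blue y w]) ->
  blue u v -> blue v w -> blue r2 v -> blue r2 w -> red r1 w || red s w ->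
  palette_colorable.
Proof.
move=> r2N wN yr h uv vw r2v r2w rsw.
have r2_neq_w : r2 != w by apply: contraTneq r2w => ->; rewrite blue_irr.
apply: (@palette_colorableI
  [:: (inl true, joined r2 v w); (inr r2, joined r1 v w);
      (inl false, joined r2 u v); (inr w, joined r1 u v)]).
- by rewrite /= !inE /eq_op /= r2_neq_w.
- by rewrite /= r2N wN.
- by do !split; apply: independent_joined.
move=> y yY; have /implyP b2 := @blue_excl y _ _ _ vw r2v r2w.
have yw : red y r1 && red y s ==> ~~ red y w.
  apply/implyP=> /andP[y1 ys]; case/orP: rsw; [exact: red_excl y1|exact: red_excl ys].
by move: b2 yw (yr y yY) (h y yY); rewrite /joined /= vw; color_cases.
Qed.

(** Without [v], the blue graph on [N] is bipartite with sides [r1], [r2], [u] and [w], [s]: a blue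
    edge [r1 r2] would give a blue K_4 with [v] and [w], and [sw] is red. So [v] alone would be a
    valid red side. *)
Lemma pair_path_same_side r1 r2 s u v w : ~~ extends [set v] ->
  v \in N -> {subset N <= [:: r1; r2; u; v; w; s]} ->
  blue u v -> blue v w -> blue r1 v -> blue r1 w -> blue r2 v -> blue r2 w ->
  ~~ blue r1 u -> ~~ blue r2 u -> red s w -> False.
Proof.
move=> ncv vN sN uv vw r1v r1w r2v r2w r1u r2u sw.
have : ~~ blue_triangle_free (N :\ v).
  apply: contra ncv => tf; apply/and3P; split=> //; first by rewrite sub1set.
  by apply/red_freeP => a b /[!inE]/eqP-> /eqP->; rewrite red_irr.
have r12 : ~~ blue r1 r2.
  by apply/negP => r12; apply: blue_K4_free r12 r1v r1w r2v r2w vw.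
have side a : a \in N :\ v -> (a \in [:: r1; r2; u]) || (a \in [:: w; s]).
  move=> /setD1P[av /sN]; rewrite !inE (negPf av) /=.
  by case: (a == r1); case: (a == r2); case: (a == u).
have noA a b : a \in [:: r1; r2; u] -> b \in [:: r1; r2; u] -> ~~ blue a b.
  by rewrite !inE => /or3P[]/eqP-> /or3P[]/eqP->; rewrite ?blue_irr // blueC.
have noC a b : a \in [:: w; s] -> b \in [:: w; s] -> ~~ blue a b.
  have := red_blue sw; rewrite !inE.
  by move=> ? /orP[]/eqP-> /orP[]/eqP->; rewrite ?blue_irr // blueC.
case/blue_triangle_freePn => a [b [c [[/side aN /side bN /side cN] [ab ac bc]]]].
case/orP: aN => aS; case/orP: bN => bS; case/orP: cN => cS;
  by [move: (noA _ _ aS bS); rewrite ab | move: (noA _ _ aS cS); rewrite ac |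
      move: (noA _ _ bS cS); rewrite bc | move: (noC _ _ aS bS); rewrite ab |
      move: (noC _ _ aS cS); rewrite ac | move: (noC _ _ bS cS); rewrite bc].
Qed.

(** Moving [r] to the blue side can fail only by creating a blue triangle, and that triangle must
    contain [r]. *)
Lemma nonextends_triangle (R : {set T}) r : extends R -> r \in R -> ~~ extends (R :\ r) ->
  exists p q, [/\ p \in N :\: R, q \in N :\: R & [&& blue p q, blue r p & blue r q]].
Proof.
case/and3P=> /subsetP RN /red_freeP rf /blue_triangle_freeP tf rR.
have -> : extends (R :\ r) = blue_triangle_free (N :\: (R :\ r)).
  rewrite /extends (_ : _ \subset N); last by apply/subsetP => u /setD1P[_ /RN].
  rewrite (_ : red_free _) //.
  by apply/red_freeP => u v /setD1P[_ uR] /setD1P[_ vR]; apply: rf.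
case/blue_triangle_freePn => a [b [c [[]]]].
have inB u : u \in N :\: (R :\ r) -> u = r \/ u \in N :\: R.
  rewrite !inE negb_and negbK; case: eqP => [->|_] /=; [by left|by right].
move=> /inB aB /inB bB /inB cB [ab ac bc].
case: aB ab ac => [->|aB] ab ac.
  exists b, c; rewrite bc ab ac.
  case: bB ab => [->|bB]; first by rewrite blue_irr.
  by case: cB ac => [->|cB]; first by rewrite blue_irr.
case: bB ab bc => [->|bB] ab bc.
  exists a, c; rewrite ac bc blueC ab; split=> //.
  by case: cB bc => [->|//]; rewrite blue_irr.
case: cB ac bc => [->|cB] ac bc; last by case: (tf a b c).
by exists a, b; rewrite ab !(blueC r) ac bc.
Qed.

(** Neither vertex can leave the red side, so [r1] lies in a blue triangle with some [cd] and [r2]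
    in one with some [ab]. Domination forces [r1] to be red to [a], [b] and [r2] to [c], [d]; the
    six vertices are then distinct and exhaust [N]. *)
Lemma extends_set2_dominating r1 r2 : extends [set r1; r2] -> r1 != r2 ->
  (forall r, ~~ extends [set r]) ->
  (forall b, b \in N :\: [set r1; r2] -> red r1 b || red r2 b) -> palette_colorable.
Proof.
move=> cR r12 nc1 dom.
have /and3P[/subsetP RN _ /blue_triangle_freeP tf] := cR.
have yr y : y \in Y -> red y r1 || red y r2.
  by move=> yY; have [[r] /[!inE]/orP[]/eqP-> ->] := extends_hit cR yY; rewrite ?orbT.
have [c [d [cB dB /and3P[cd r1c r1d]]]] :
    exists p q, [/\ p \in N :\: [set r1; r2], q \in N :\: [set r1; r2] &
                   [&& blue p q, blue r1 p & blue r1 q]].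
  apply: nonextends_triangle => //; first by rewrite !inE eqxx.
  rewrite (_ : _ :\ r1 = [set r2]) //; apply/setP => u; rewrite !inE.
  by case: eqP => [->|//]; rewrite (negPf r12).
have [a [b [aB bB /and3P[ab r2a r2b]]]] :
    exists p q, [/\ p \in N :\: [set r1; r2], q \in N :\: [set r1; r2] &
                   [&& blue p q, blue r2 p & blue r2 q]].
  apply: nonextends_triangle => //; first by rewrite !inE eqxx orbT.
  rewrite (_ : _ :\ r2 = [set r1]) //; apply/setP => u; rewrite !inE.
  by case: (u =P r2) => [->|//]; rewrite ?orbF // eq_sym (negPf r12).
have nrb u v : blue u v -> red u v = false.
  by move=> uv; apply/negP => /red_blue; rewrite uv.
have r1a : red r1 a by have := dom a aB; rewrite (nrb _ _ r2a) orbF.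
have r1b : red r1 b by have := dom b bB; rewrite (nrb _ _ r2b) orbF.
have r2c : red r2 c by have := dom c cB; rewrite (nrb _ _ r1c).
have r2d : red r2 d by have := dom d dB; rewrite (nrb _ _ r1d).
have neq_col u v w : red u v -> blue u w -> v != w.
  by move=> uv uw; apply: contraTneq uw => <-; apply: red_blue.
have uB : uniq [:: a; b; c; d].
  have blue_neq u v : blue u v -> u != v by apply: contraTneq => ->; rewrite blue_irr.
  by rewrite /= !inE !negb_or (blue_neq _ _ ab) (blue_neq _ _ cd) !(neq_col r1).
have NE : N :\: [set r1; r2] =i [:: a; b; c; d].
  have sB : {subset [:: a; b; c; d] <= N :\: [set r1; r2]}.
    by move=> u; rewrite !inE => /or4P[]/eqP->; move: aB bB cB dB; rewrite !inE.
  have [|||_ E] := @uniq_min_size _ [:: a; b; c; d] (enum (N :\: [set r1; r2])) => //.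
  - by move=> u uL; rewrite mem_enum; apply: sB.
  - by rewrite -cardE (leq_trans (card_extendsC cR)) // cards2 r12.
  by move=> u; rewrite E mem_enum.
have sN : {subset [:: r1; r2; a; b; c; d] <= N}.
  move=> u; rewrite [u \in _]inE [u \in _ :: _]inE orbA -NE => /orP[e|/setDP[]//].
  by apply: RN; rewrite !inE.
have uq : uniq [:: r1; r2; a; b; c; d].
  rewrite 2!cons_uniq uB andbT inE negb_or r12 -!NE !inE !eqxx ?orbT //.
have hY y : y \in Y -> [|| [&& blue a b, blue y a & blue y b],
    [&& blue a c, blue y a & blue y c], [&& blue a d, blue y a & blue y d],
    [&& blue b c, blue y b & blue y c], [&& blue b d, blue y b & blue y d] |
    [&& blue c d, blue y c & blue y d]].
  move=> yY; have [_ [p [q []]]] := extends_hit cR yY; rewrite !NE !inE.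
  by move=> /or4P[]/eqP-> /or4P[]/eqP->; rewrite ?blue_irr // ?(blueC b a) ?(blueC c a)
    ?(blueC d a) ?(blueC c b) ?(blueC d b) ?(blueC d c); color_cases.
have [tacd tbcd tabc tabd] : [/\ ~~ (blue a c && blue a d), ~~ (blue b c && blue b d),
    ~~ (blue a c && blue b c) & ~~ (blue a d && blue b d)].
  split; apply/negP => /andP[e1 e2]; [apply: (tf a c d)|apply: (tf b c d)|
    apply: (tf a b c)|apply: (tf a b d)] => //.
(* As [ab] and [cd] are blue and the blue side has no triangle, the blue edges between these pairs
   form a matching. *)
have /orP[/andP[e1 e2]|/andP[e1 e2]] :
    (~~ blue a d && ~~ blue b c) || (~~ blue a c && ~~ blue b d).
  by move: tacd tbcd tabc tabd; color_cases.
- apply: (@pair_cross r1 r2 a b c d) => // y yY.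
  by move: e1 e2 (hY y yY); color_cases.
- apply: (@pair_cross r1 r2 a b d c) => //; last 1 first.
  + by move=> y yY; move: e1 e2 (hY y yY); color_cases.
  + by move=> u uL; apply: sN; move: uL; rewrite !inE; do 6 case: (u == _) => //=.
  + by rewrite -(perm_uniq (s1 := [:: r1; r2; a; b; c; d])) // !perm_cons (perm_catC [:: c] [:: d]).
  by rewrite blueC.
Qed.

Lemma red_freeU1 (R : {set T}) u : red_free R -> (forall r, r \in R -> ~~ red u r) ->
  red_free (u |: R).
Proof.
move=> /red_freeP rf ur; apply/red_freeP => a b; rewrite !in_setU1.
by move=> /orP[/eqP->|aR] /orP[/eqP->|bR];
  [rewrite red_irr|exact: ur|rewrite redC ur|exact: rf].
Qed.

(** Adding [s] to the red side leaves at most three vertices, with blue edges on a path [u v w]. The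
    cases are whether [r1] and [r2] can then leave the red side: both gives a majority argument,
    exactly one the one-sided argument, and neither makes both blue to [v] and to an end of the
    path. *)
Lemma extends_set2_path r1 r2 s : extends [set r1; r2] -> r1 != r2 ->
  (forall r, ~~ extends [set r]) ->
  s \in N :\: [set r1; r2] -> ~~ red r1 s -> ~~ red r2 s -> palette_colorable.
Proof.
move=> cR r12 nc1; rewrite !inE negb_or => /andP[/andP[sr1 sr2] sN] r1s r2s.
have [/subsetP RN /red_freeP rf _] := and3P cR.
have r1N : r1 \in N by apply: RN; rewrite !inE eqxx.
have r2N : r2 \in N by apply: RN; rewrite !inE eqxx orbT.
have cR' : extends [set r1; r2; s].
  apply: (extendsS cR); first exact: subsetUl.
    by apply/subsetP => u; rewrite !inE -orbA => /or3P[]/eqP->.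
  by apply: red_free3 => //; apply: rf; rewrite !inE eqxx ?orbT.
have R'3 : #|[set r1; r2; s]| = 3 by rewrite cards3 // eq_sym.
have yr y : y \in Y -> red y r1 || red y r2.
  by move=> yY; have [[r] /[!inE]/orP[]/eqP-> ->] := extends_hit cR yY; rewrite ?orbT.
have [|u [v [w [[uB vB wB] [sB uw h]]]]] := extends3_hit cR'.
  by rewrite (leq_trans (card_extendsC cR')) // R'3.
have [uv|uv] := boolP (blue u v); last first.
  by apply: (@pair_edge r1 r2 v w) => // y yY; move: (h y yY); rewrite (negPf uv).
have [vw|vw] := boolP (blue v w); last first.
  by apply: (@pair_edge r1 r2 u v) => // y yY; move: (h y yY); rewrite (negPf vw) orbF.
have uwB : {subset N :\: [set r1; r2; s] <= [:: w; v; u]}.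
  by move=> x /sB; rewrite !inE; do 3 case: (x == _).
(* An end of the path with no red neighbour in the red side could be added to it, leaving [vz] as
   the only blue edge. *)
have end_red x z : x \in N :\: [set r1; r2; s] ->
    {subset N :\: [set r1; r2; s] <= [:: x; v; z]} ->
    [|| red r1 x, red r2 x | red s x] \/ palette_colorable.
  move=> xB sBx; have [|] := boolP [|| red r1 x, red r2 x | red s x]; first by left.
  rewrite !negb_or => /and3P[r1x r2x sx]; right.
  have cX : extends (x |: [set r1; r2; s]).
    apply: (extendsS cR'); first exact: subsetUr.
      apply/subsetP => t /setU1P[->|tR']; first by case/setDP: xB.
      by have /and3P[/subsetP sN' _ _] := cR'; apply: sN'.
    apply: red_freeU1; first by have /and3P[] := cR'.
    by move=> t; rewrite !inE -orbA redC => /or3P[]/eqP->.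
  apply: (@pair_edge r1 r2 v z) => // y yY.
  have [_ [p [q [pX qX e]]]] := extends_hit cX yY.
  have sX t : t \in N :\: (x |: [set r1; r2; s]) -> (t == v) || (t == z).
    rewrite setUC -setDDl => /setD1P[tx /sBx].
    by rewrite !inE (negPf tx).
  move: e; case/orP: (sX p pX) => /eqP->; case/orP: (sX q qX) => /eqP->;
    by rewrite ?blue_irr // (blueC z v); color_cases.
have [ru|//] := end_red u w uB sB; have [rw|//] := end_red w u wB uwB.
have unextended x : x \in [set r1; r2; s] -> ~~ extends ([set r1; r2; s] :\ x) ->
    blue x v && (blue x u || blue x w).
  move=> xR' nc; have [p [q [/sB pB /sB qB e]]] := nonextends_triangle cR' xR' nc.
  by move: (edge3 pB qB uw e); color_cases.
have hyr x x' : extends ([set r1; r2; s] :\ x) -> [set r1; r2; s] :\ x =i [set x'; s] -> 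
    forall y, y \in Y -> red y x' || red y s.
  move=> cx E y yY; have [[r] rR yrr _] := extends_hit cx yY.
  by move: rR yrr; rewrite E !inE => /orP[]/eqP-> ->; rewrite ?orbT.
have E1 : [set r1; r2; s] :\ r1 =i [set r2; s].
  move=> t; rewrite !inE; case: eqP => [->|//]; by rewrite (negPf r12) eq_sym (negPf sr1).
have E2 : [set r1; r2; s] :\ r2 =i [set r1; s].
  move=> t; rewrite !inE; case: (t =P r2) => [->|//]; rewrite ?orbF //.
  by rewrite (eq_sym r2) (negPf r12) (eq_sym r2) (negPf sr2).
have wvu : [/\ blue w v, blue v u & forall y, y \in Y ->
    [&& blue w v, blue y w & blue y v] || [&& blue v u, blue y v & blue y u]].
  rewrite (blueC w) (blueC v u); split=> // y yY; move: (h y yY); color_cases.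
have [wv vu h'] := wvu.
have nrb a b : blue a b -> red a b = false.
  by move=> ab; apply/negP => /red_blue; rewrite ab.
have one_sided1 : extends ([set r1; r2; s] :\ r1) -> blue r2 v ->
    blue r2 u || blue r2 w -> palette_colorable.
  move=> /hyr/(_ E1) yrs r2v /orP[r2u|r2w].
  - apply: (@pair_path_one_sided r1 r2 s w v u); rewrite //; try by case/setDP: uB.
      by move=> y yY; rewrite yr ?yrs.
    by move: ru; rewrite (nrb _ _ r2u).
  - apply: (@pair_path_one_sided r1 r2 s u v w); rewrite //; try by case/setDP: wB.
      by move=> y yY; rewrite yr ?yrs.
    by move: rw; rewrite (nrb _ _ r2w).
have yr' y : y \in Y -> red y r2 || red y r1 by move=> yY; rewrite orbC yr.
have one_sided2 : extends ([set r1; r2; s] :\ r2) -> blue r1 v ->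
    blue r1 u || blue r1 w -> palette_colorable.
  move=> /hyr/(_ E2) yrs r1v /orP[r1u|r1w].
  - apply: (@pair_path_one_sided r2 r1 s w v u); rewrite //; try by case/setDP: uB.
      by move=> y yY; rewrite yr' ?yrs.
    by move: ru; rewrite (nrb _ _ r1u).
  - apply: (@pair_path_one_sided r2 r1 s u v w); rewrite //; try by case/setDP: wB.
      by move=> y yY; rewrite yr' ?yrs.
    by move: rw; rewrite (nrb _ _ r1w).
have r1R : r1 \in [set r1; r2; s] by rewrite !inE eqxx.
have r2R : r2 \in [set r1; r2; s] by rewrite !inE eqxx orbT.
have [c1|/(unextended r1 r1R)/andP[r1v r1uw]] := boolP (extends ([set r1; r2; s] :\ r1)).
  have [c2|/(unextended r2 r2R)/andP[r2v r2uw]] := boolP (extends ([set r1; r2; s] :\ r2)).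
    apply: (@pair_path_majority r1 r2 s u v w) => // y yY.
    by rewrite yr // (hyr _ _ c1 E1) // (hyr _ _ c2 E2).
  exact: one_sided1.
have [c2|/(unextended r2 r2R)/andP[r2v r2uw]] := boolP (extends ([set r1; r2; s] :\ r2)).
  exact: one_sided2.
have vN : v \in N by case/setDP: vB.
have sN6 x z : {subset N :\: [set r1; r2; s] <= [:: x; v; z]} ->
    {subset N <= [:: r1; r2; x; v; z; s]}.
  move=> sBx t tN; have := sBx t; rewrite !inE tN andbT -orbA.
  case: (t == r1); case: (t == r2); case: (t == s) => //= tx; rewrite ?orbT //.
  by case/or3P: (tx isT) => ->; rewrite ?orbT.
(* If [r1] and [r2] can be assigned different ends of the path, the alternating colouring applies.
   Otherwise both are blue to one and the same end only, which is impossible. *)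
case r1u: (blue r1 u) r1uw => /= r1w; case r2u: (blue r2 u) r2uw => /= r2w.
- have [r1w'|r1w'] := boolP (blue r1 w).
    by apply: (@pair_path_alternate r2 r1 u v w) => //; rewrite eq_sym.
  have [r2w'|r2w'] := boolP (blue r2 w); first exact: (@pair_path_alternate r1 r2 u v w).
  case: (@pair_path_same_side r1 r2 s w v u) => //; first exact: sN6.
  by move: ru; rewrite (nrb _ _ r1u) (nrb _ _ r2u).
- exact: (@pair_path_alternate r1 r2 u v w).
- by apply: (@pair_path_alternate r2 r1 u v w) => //; rewrite eq_sym.
case: (@pair_path_same_side r1 r2 s u v w) => //; first exact: sN6.
- by rewrite r1u.
- by rewrite r2u.
by move: rw; rewrite (nrb _ _ r1w) (nrb _ _ r2w).
Qed.

Lemma extends_set2 r1 r2 : extends [set r1; r2] -> r1 != r2 ->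
  (forall r, ~~ extends [set r]) -> palette_colorable.
Proof.
move=> cR r12 nc1.
have [/exists_inP[s sB /norP[r1s r2s]]|no] :=
  boolP [exists s in N :\: [set r1; r2], ~~ (red r1 s || red r2 s)].
  exact: (extends_set2_path cR r12 nc1 sB r1s r2s).
apply: (extends_set2_dominating cR r12 nc1) => b bB.
by apply/negPn/negP => rb; case/negP: no; apply/exists_inP; exists b.
Qed.

(** * Smallest red side of size at least three *)

(** With [p] and [q] outside [R], at most four red neighbours are possible. No [y] is blue to a
    vertex of [R], so a [y] not red to [r1] may take the colour of [r1], and likewise for [r2]. *)
Lemma extends_monochromatic (R : {set T}) p q : extends R -> 3 <= #|R| ->
  p \in N :\: R -> q \in N :\: R ->
  (forall r, r \in R -> blue r p && blue r q) ->
  (forall y, y \in Y -> [&& blue p q, blue y p & blue y q]) -> palette_colorable.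
Proof.
move=> cR R3 pB qB rpq h; have /and3P[/subsetP RN _ _] := cR.
have [y0 y0Y] := set0Pn _ Y_neq0; have /and3P[pq _ _] := h y0 y0Y.
have R4 : #|R| <= 4.
  have : #|[set p; q]| <= #|N :\: R|.
    by apply/subset_leq_card/subsetP => t /set2P[]->.
  have -> : #|[set p; q]| = 2 by rewrite cards2 (contraTneq _ pq) // => ->; rewrite blue_irr.
  by move=> B2; have := leq_trans B2 (card_extendsC cR); rewrite ltn_subRL addn1.
have [r1 [r2 [r3 [r4 [r12 r1R r2R sR]]]]] : exists r1 r2 r3 r4,
    [/\ r1 != r2, r1 \in R, r2 \in R & {subset R <= [:: r1; r2; r3; r4]}].
  have mE t : (t \in enum R) = (t \in R) by rewrite mem_enum.
  have := enum_uniq R; move: mE R3 R4; rewrite cardE.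
  case: (enum R) => [|a [|b [|c [|d []]]]] //= mE _ _; rewrite !inE !negb_or => /andP[/andP[ab _] _].
    by exists a, b, c, c; split; rewrite -?mE ?inE ?eqxx ?orbT // => t;
      rewrite -mE !inE => /or3P[]->; rewrite ?orbT.
  by exists a, b, c, d; split; rewrite -?mE ?inE ?eqxx ?orbT // => t; rewrite -mE.
apply: (@palette_colorableI
  [:: (inl true, joined r1 p q); (inl false, joined r2 p q);
      (inr r1, joined r3 p q); (inr r2, joined r4 p q)]).
- by rewrite /= !inE /eq_op /= r12.
- by rewrite /= !RN.
- by do !split; apply: independent_joined.
move=> y yY; have /and3P[_ yp yq] := h y yY.
have nb r : r \in R -> ~~ blue y r.
  by move=> /rpq/andP[rp rq]; apply: (@blue_excl y r p q) => //; rewrite yp.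
have [[r /sR rR yr] _] := extends_hit cR yY.
have {rR} : [|| red y r1, red y r2, red y r3 | red y r4].
  by move: rR yr; rewrite !inE => /or4P[]/eqP-> ->; rewrite ?orbT.
move: (nb _ r1R) (nb _ r2R); rewrite /joined /= pq yp yq.
by color_cases.
Qed.

(** By minimality every [r] in [R] is in a blue triangle with [uv] or [vw]. If only one of these is
    blue, it serves all of [R] and [Y]; if both are, [v] alone would be a smaller red side. *)
Lemma extends_minimal_large (R : {set T}) : extends R -> 3 <= #|R| ->
  (forall R', extends R' -> #|R| <= #|R'|) -> palette_colorable.
Proof.
move=> cR R3 minR.
have ncR r : r \in R -> ~~ extends (R :\ r).
  move=> rR; apply/negP => /minR; by rewrite (cardsD1 r R) rR ltnn.
have B3 : #|N :\: R| <= 3 by rewrite (leq_trans (card_extendsC cR)) // leq_subLR (leq_add2r 3 3).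
have [u [v [w [[uB vB wB] [sB uw h]]]]] := extends3_hit cR B3.
have rB r : r \in R ->
    [&& blue u v, blue r u & blue r v] || [&& blue v w, blue r v & blue r w].
  move=> rR; have [p [q [/sB pB /sB qB e]]] := nonextends_triangle cR rR (ncR r rR).
  exact: edge3 pB qB uw e.
have [uv|uv] := boolP (blue u v); last first.
  apply: (extends_monochromatic cR R3 vB wB) => [r /rB|y /h]; rewrite (negPf uv) //=.
  by case/andP.
have [vw|vw] := boolP (blue v w); last first.
  apply: (extends_monochromatic cR R3 uB vB) => [r /rB|y /h]; rewrite (negPf vw) orbF //=.
  by case/andP.
(* Now [v] is joined in blue to all of [N], so [N :\ v] spans no blue triangle. *)
suff /minR : extends [set v] by rewrite cards1 leqNgt (leq_trans _ R3).
apply/and3P; split; first by rewrite sub1set; case/setDP: vB.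
  by apply/red_freeP => a b /[!inE]/eqP-> /eqP->; rewrite red_irr.
have vE a : a \in N :\ v -> blue v a.
  move=> /setD1P[av aN]; have [aR|aR] := boolP (a \in R).
    by rewrite blueC; move: (rB a aR); color_cases.
  have /sB : a \in N :\: R by rewrite !inE aR.
  by rewrite !inE (negPf av) /= => /orP[]/eqP->; rewrite // blueC.
apply/blue_triangle_freeP => a b c /vE va /vE vb /vE vc ab ac bc.
exact: blue_K4_free va vb vc ab ac bc.
Qed.

Lemma extends_palette_colorable (R : {set T}) : extends R -> palette_colorable.
Proof.
move=> cR; case: (arg_minnP (fun A : {set T} => #|A|) cR) => {cR}R cR minR.
have [/existsP[r] /extends_set1 //|/existsPn nc1] := boolP [exists r, extends [set r]].
have [R3|R3] := leqP 3 #|R|; first exact: extends_minimal_large cR R3 minR.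
case E: #|R| R3 => [|[|[|//]]] _.
- have [y yY] := set0Pn _ Y_neq0; have [[r]] := extends_hit cR yY.
  by rewrite (cards0_eq E) inE.
- by have /cards1P[r Er] := introT eqP E; move: (nc1 r); rewrite -Er cR.
have /cards2P[r1 [r2 [r12 ER]]] : #|R| == 2 by rewrite E.
by apply: (@extends_set2 r1 r2) => //; rewrite -ER.
Qed.
End Extension.

(** * The minimum degree of a co-critical graph *)

Section Recolouring.

Variables (G : sgraph) (c : {set G} -> bool) (x y : G).
Local Notation red := (@color_rel G c true).
Local Notation blue := (@color_rel G c false).
Hypothesis no_red : ~ has_copy 'K_3 (color_graph c true).
Hypothesis no_blue : ~ has_copy 'K_4 (color_graph c false).
Hypotheses (xy : x != y) (nxy : ~~ (x -- y)).
Local Notation N := [set v : G | x -- v].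

(** Only edges at [x] change: red towards [R], blue towards the rest of [N], and [b] is the colour
    of the new edge. *)
Definition recolor (R : {set G}) (b : bool) (A : {set add_edge x y}) : bool :=
  if x \in A then [exists r in R, r \in A] || b && (y \in A) else c A.

Lemma recolor_off R b t (u v : G) : u != x -> v != x ->
  @color_rel (add_edge x y) (recolor R b) t u v = @color_rel G c t u v.
Proof.
move=> ux vx; rewrite /color_rel /recolor /= /add_edge_rel.
rewrite (negPf (_ : x \notin [set u; v])); last by rewrite !inE !(eq_sym x) negb_or ux.
case: ([set u; v] =P [set x; y]) => [E|_]; last by rewrite andbF orbF.
by have := set21 x y; rewrite -E !inE !(eq_sym x) (negPf ux) (negPf vx).
Qed.

Lemma recolor_red (R : {set G}) b (v : G) : R \subset N -> v != x ->
  @color_rel (add_edge x y) (recolor R b) true x v = (v \in R) || b && (v == y).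
Proof.
move=> /subsetP RN vx; rewrite /color_rel /recolor /= /add_edge_rel set21 eqb_id.
have xR : x \notin R by apply/negP => /RN; rewrite inE sedge_irr.
have -> : [exists r in R, r \in [set x; v]] = (v \in R).
  apply/exists_inP/idP => [[r rR /set2P[rx|<-//]]|vR]; first by rewrite -rx rR in xR.
  by exists v => //; rewrite set22.
have -> : (y \in [set x; v]) = (v == y) by rewrite !inE eq_sym (negPf xy) eq_sym.
have -> : ([set x; v] == [set x; y]) = (v == y).
  apply/eqP/eqP => [E|-> //]; have := set22 x v; rewrite E !inE (negPf vx) /=.
  by move/eqP.
rewrite eq_sym vx /=; have [/RN|] := boolP (v \in R); first by rewrite inE => ->.
by case: b; case: (v == y); rewrite ?andbF ?orbT ?orbF.
Qed.

Lemma recolor_blue (R : {set G}) b (v : G) : R \subset N -> v != x ->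
  @color_rel (add_edge x y) (recolor R b) false x v =
  (v \in N :\: R) || ~~ b && (v == y).
Proof.
move=> RN vx; have := @recolor_red R b v RN vx.
rewrite /color_rel eqb_id /= eqbF_neg.
have -> : @add_edge_rel G x y x v = (x -- v) || (v == y).
  rewrite /add_edge_rel eq_sym vx /=; congr orb.
  apply/eqP/eqP => [E|-> //]; have := set22 x v; rewrite E !inE (negPf vx) /=.
  by move/eqP.
have [->|vy] := eqVneq v y; last first.
  rewrite !andbF !orbF !inE => H; case: (x -- v) H => /= [->|_]; by rewrite ?andbT ?andbF.
rewrite !inE !orbT (negPf nxy) andbF !andbT /= => ->.
suff -> : y \in R = false by [].
by apply/negP => /(subsetP RN); rewrite inE (negPf nxy).
Qed.

(** Away from [x] the colouring is the old one, so a red triangle must contain [x]; the lemma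
    returns its other two vertices. *)
Lemma recolor_triangle (R : {set G}) b : R \subset N ->
  has_copy 'K_3 (color_graph (recolor R b) true) ->
  exists u v : G, [/\ (u \in R) || b && (u == y), (v \in R) || b && (v == y) & red u v].
Proof.
move=> RN /has_copy3P[u [v [w []]]] /=.
set r' := color_rel _ _ => uv uw vw.
have r'C : symmetric r' := @color_sym (add_edge x y) _ _.
have aux (p q : G) : r' x p -> r' x q -> r' p q ->
    exists u v : G, [/\ (u \in R) || b && (u == y), (v \in R) || b && (v == y) & red u v].
  move=> xp xq pq.
  have px : p != x by apply: contraTneq xp => ->; rewrite /r' color_irr.
  have qx : q != x by apply: contraTneq xq => ->; rewrite /r' color_irr.
  exists p, q; split; first by rewrite -(recolor_red b RN px).
    by rewrite -(recolor_red b RN qx).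
  by rewrite -(recolor_off R b true px qx).
have [ux|ux] := eqVneq u x; first by rewrite ux in uv uw; apply: aux uv uw vw.
have [vx|vx] := eqVneq v x; first by rewrite vx in uv vw; apply: aux vw uw; rewrite r'C.
have [wx|wx] := eqVneq w x; first by rewrite wx in uw vw; apply: (aux u v); rewrite // r'C.
case: no_red; apply/has_copy3P; exists u, v, w.
by split; rewrite /= -(recolor_off R b).
Qed.

Lemma recolor_K4 (R : {set G}) b : R \subset N ->
  has_copy 'K_4 (color_graph (recolor R b) false) ->
  exists u v w : G, [/\ (u \in N :\: R) || ~~ b && (u == y),
    (v \in N :\: R) || ~~ b && (v == y) & (w \in N :\: R) || ~~ b && (w == y)] /\
    [/\ blue u v, blue u w & blue v w].
Proof.
move=> RN /has_copy4P[u [v [w [z [[]]]]]] /=.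
set r' := color_rel _ _ => uv uw uz [vw vz wz].
have r'C : symmetric r' := @color_sym (add_edge x y) _ _.
have aux (p q s : G) : r' x p -> r' x q -> r' x s -> r' p q -> r' p s -> r' q s ->
    exists u v w : G, [/\ (u \in N :\: R) || ~~ b && (u == y),
    (v \in N :\: R) || ~~ b && (v == y) & (w \in N :\: R) || ~~ b && (w == y)] /\
    [/\ blue u v, blue u w & blue v w].
  move=> xp xq xs pq ps qs.
  have px : p != x by apply: contraTneq xp => ->; rewrite /r' color_irr.
  have qx : q != x by apply: contraTneq xq => ->; rewrite /r' color_irr.
  have sx : s != x by apply: contraTneq xs => ->; rewrite /r' color_irr.
  exists p, q, s; split; split.
  - by rewrite -(recolor_blue b RN px).
  - by rewrite -(recolor_blue b RN qx).
  - by rewrite -(recolor_blue b RN sx).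
  - by rewrite -(recolor_off R b false px qx).
  - by rewrite -(recolor_off R b false px sx).
  - by rewrite -(recolor_off R b false qx sx).
have [ux|ux] := eqVneq u x; first by rewrite ux in uv uw uz; apply: aux uv uw uz vw vz wz.
have [vx|vx] := eqVneq v x.
  by rewrite vx in uv vw vz; apply: (aux u w z); rewrite // r'C.
have [wx|wx] := eqVneq w x.
  by rewrite wx in uw vw wz; apply: (aux u v z); rewrite // r'C.
have [zx|zx] := eqVneq z x.
  by rewrite zx in uz vz wz; apply: (aux u v w); rewrite // r'C.
case: no_blue; apply/has_copy4P; exists u, v, w, z.
by split; split; rewrite /= -(recolor_off R b).
Qed.

Hypothesis add_arrows : arrows (add_edge x y) 'K_3 'K_4.

Lemma recolor_extends_hit (R : {set G}) : extends red blue N R ->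
  (exists2 r, r \in R & red y r) /\
  exists p q, [/\ p \in N :\: R, q \in N :\: R & [&& blue p q, blue y p & blue y q]].
Proof.
case/and3P=> RN /red_freeP rf /blue_triangle_freeP tf; split.
  (* With [xy] red, a blue K_4 would need a blue triangle in [N :\: R], so there is a red triangle
     through [xy]. Making [xy] blue below gives a blue K_4 through it in the same way. *)
  case: (add_arrows (recolor R true)) => [/(recolor_triangle RN)|/(recolor_K4 RN)].
    move=> [u [v [/orP[uR|/eqP->] /orP[vR|/eqP->]]]]; rewrite ?color_irr //= => uv.
    - by have := rf u v uR vR; rewrite uv.
    - by exists u => //; rewrite color_sym.
    - by exists v.
  move=> [u [v [w [[]]]]]; rewrite /= !orbF => uB vB wB [uv uw vw].
  by case: (tf u v w).
case: (add_arrows (recolor R false)) => [/(recolor_triangle RN)|/(recolor_K4 RN)].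
  move=> [u [v []]]; rewrite /= !orbF => uR vR uv.
  by have := rf u v uR vR; rewrite uv.
move=> [u [v [w [[/orP[uB|/eqP->] /orP[vB|/eqP->] /orP[wB|/eqP->]]]]]];
  rewrite ?color_irr; case=> // uv uw vw.
- by case: (tf u v w).
- by exists u, v; rewrite !(@color_sym G c false y) uv uw vw.
- by exists u, w; rewrite uw vw (@color_sym G c false y) uv.
by exists v, w; rewrite uv uw vw.
Qed.

End Recolouring.

(** Finiteness makes the case distinction constructive. *)
Lemma has_copy3_dec (G : sgraph) : has_copy 'K_3 G \/ ~ has_copy 'K_3 G.
Proof.
have [/existsP[a /existsP[b /existsP[c /and3P[]]]]|no] :=
  boolP [exists a : G, exists b : G, exists c : G, [&& a -- b, a -- c & b -- c]].
  by move=> *; left; apply/has_copy3P; exists a, b, c.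
right=> /has_copy3P[a [b [c [ab ac bc]]]]; case/negP: no.
by apply/existsP; exists a; apply/existsP; exists b; apply/existsP; exists c; apply/and3P.
Qed.

Lemma has_copy4_dec (G : sgraph) : has_copy 'K_4 G \/ ~ has_copy 'K_4 G.
Proof.
have [/existsP[a /existsP[b /existsP[c /existsP[d /andP[/and3P[? ? ?] /and3P[? ? ?]]]]]]|no] :=
  boolP [exists a : G, exists b : G, exists c : G, exists d : G,
    [&& a -- b, a -- c & a -- d] && [&& b -- c, b -- d & c -- d]].
  by left; apply/has_copy4P; exists a, b, c, d.
right=> /has_copy4P[a [b [c [d [[ab ac ad] [bc bd cd]]]]]]; case/negP: no.
apply/existsP; exists a; apply/existsP; exists b; apply/existsP; exists c; apply/existsP; exists d.
by apply/andP; split; apply/and3P.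
Qed.

(** * From a palette to an 8-colouring *)

Section SmallDegree.

Variables (G : sgraph) (c : {set G} -> bool) (x : G).
Local Notation red := (@color_rel G c true).
Local Notation blue := (@color_rel G c false).
Hypothesis no_red : ~ has_copy 'K_3 (color_graph c true).
Hypothesis no_blue : ~ has_copy 'K_4 (color_graph c false).
Local Notation N := [set v : G | x -- v].
Local Notation Y := (~: (x |: N)).

Lemma color_relE (u v : G) : red u v || blue u v = (u -- v).
Proof. by rewrite /color_rel -andb_orr; case: (c _); rewrite andbT. Qed.

Hypothesis xN_le6 : #|N| <= 6.

Lemma palette_coloring8 (y0 : G) : y0 \in Y -> palette_colorable red blue N Y ->
  exists f : G -> 'I_8, forall u v : add_edge x y0, u -- v -> f u != f v.
Proof.
move=> y0Y [k [kN kY]].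
(* [x] takes a new colour, different from that of [y0], its only neighbour in [Y] after the edge is
   added. *)
pose kx : bool + G := if k y0 is inl b then inl (~~ b) else inl true.
pose col v : bool + G := if v == x then kx else if x -- v then inr v else k v.
(* Vertices of [N] get numbers below 6, since [N] has at most six elements; the new colours are 6
   and 7. *)
pose enc (t : bool + G) := match t with inl b => 6 + b | inr h => index h (enum N) end.
pose valid (t : bool + G) := if t is inr h then h \in N else true.
have kxE : exists b, kx = inl b by rewrite /kx; case: (k y0) => b; eexists.
have inY v : v \in Y = (v != x) && ~~ (x -- v) by rewrite !inE negb_or.
have colN v : x -- v -> col v = inr v.
  by move=> xv; rewrite /col xv; case: eqP xv => // ->; rewrite sedge_irr.
have colY v : v \in Y -> col v = k v.
  by rewrite inY => /andP[/negPf vx /negPf xv]; rewrite /col vx xv.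
have colx : col x = kx by rewrite /col eqxx.
have tri v : [\/ v = x, x -- v | v \in Y].
  rewrite inY; have [->|vx] := eqVneq v x; first by constructor 1.
  by have [xv|xv] := boolP (x -- v); [constructor 2|constructor 3].
have colV v : valid (col v).
  case: (tri v) => [->|xv|vY].
  - by rewrite colx; have [b ->] := kxE.
  - by rewrite colN // /valid inE.
  rewrite colY // /valid; case kv: (k v) => [//|h].
  by have [_ /(_ _ kv)] := kN v vY.
have idx h : h \in N -> index h (enum N) < 6.
  by move=> hN; rewrite (leq_trans _ xN_le6) // cardE index_mem mem_enum.
have enc8 t : valid t -> enc t < 8.
  by case: t => [[]//|h /idx hN]; apply: leq_trans hN _.
have enc_inj s t : valid s -> valid t -> enc s = enc t -> s = t.
  case: s t => [b|h] [b'|h'] //= sV tV.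
  - by case: b b' {sV tV} => [] [].
  - by move=> E; have := idx _ tV; rewrite -E; case: b {E sV}.
  - by move=> E; have := idx _ sV; rewrite E; case: b' {E tV}.
  by move=> E; congr inr; rewrite -[h](nth_index x (s := enum N)) ?mem_enum // E nth_index ?mem_enum.
have NY u v : x -- u -> v \in Y -> (@sedge (add_edge x y0) u v) -> inr u != k v.
  move=> xu vY; rewrite /= /add_edge_rel.
  have ux : u != x by apply: contraTneq xu => ->; rewrite sedge_irr.
  have vx : v != x by move: vY; rewrite inY => /andP[].
  have -> : ([set u; v] == [set x; y0]) = false.
    apply/eqP => E; have := set21 x y0; rewrite -E !inE !(eq_sym x).
    by rewrite (negPf ux) (negPf vx).
  rewrite andbF orbF -color_relE => uv; apply/eqP => kv.
  have [+ _] := kN v vY; rewrite -kv /= !(@color_sym G c _ v) -negb_or uv.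
  by [].
have xY v : v \in Y -> (@sedge (add_edge x y0) x v) -> kx != k v.
  rewrite inY /= /add_edge_rel => /andP[vx /negPf->] /=.
  rewrite eq_sym vx /= => /eqP E; have := set22 x v; rewrite E !inE (negPf vx) /= => /eqP->.
  by rewrite /kx; case: (k y0) => [[]|h].
have col_neq u v : (@sedge (add_edge x y0) u v) -> col u != col v.
  have sym : (@sedge (add_edge x y0) u v) = (@sedge (add_edge x y0) v u).
    exact: sedge_sym.
  case: (tri u) (tri v) => [->|xu|uY] [->|xv|vY] uv.
  - by move: uv; rewrite sedge_irr.
  - by rewrite colx colN //; have [b ->] := kxE.
  - by rewrite colx colY //; apply: xY.
  - by rewrite colx colN //; have [b ->] := kxE.
  - rewrite !colN //; apply: contraTneq uv => [[->]].
    by rewrite (@sedge_irr (add_edge x y0)).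
  - by rewrite (colN u) // (colY v) //; apply: NY.
  - by rewrite colx colY // eq_sym; apply: xY => //; rewrite sedge_sym.
  - by rewrite (colN v) // (colY u) // eq_sym; apply: NY => //; rewrite -sym.
  rewrite !colY //; apply: kY => //; rewrite color_relE.
  move: uv; rewrite /= /add_edge_rel => /orP[//|/andP[_ /eqP E]].
  have := set21 x y0; rewrite -E !inE.
  by move: uY vY; rewrite !inY !(eq_sym _ x) => /andP[/negPf-> _] /andP[/negPf-> _].
exists (fun v => inord (enc (col v))) => u v uv.
apply: contra (col_neq u v uv) => /eqP/(congr1 val); rewrite /= !inordK ?enc8 //.
by move=> /enc_inj -> //.
Qed.

End SmallDegree.

Lemma co_critical_degree (G : sgraph) (x : G) :
  co_critical 'K_3 'K_4 G -> 9 <= #|G| -> 7 <= degree x.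
Proof.
move=> [_ nar addG] G9; rewrite leqNgt ltnS; apply/negP => x6.
apply: nar => c.
have [|no_red] := has_copy3_dec (color_graph c true); first by left.
have [|no_blue] := has_copy4_dec (color_graph c false); first by right.
set N := [set v | x -- v]; pose Y := ~: (x |: N).
(* [x] and its at most six neighbours do not exhaust nine vertices. *)
have /set0Pn[y0 y0Y] : Y != set0.
  rewrite -card_gt0 cardsCs setCK subn_gt0 (leq_trans _ G9) // ltnS cardsU1.
  exact: leq_trans (leq_add (leq_b1 _) x6) _.
have YP y : y \in Y -> x != y /\ ~~ (x -- y).
  by rewrite !inE negb_or eq_sym => /andP[].
have red_tf (u v w : G) : color_rel c true u v -> color_rel c true u w ->
    color_rel c true v w -> False.
  by move=> uv uw vw; apply: no_red; apply/has_copy3P; exists u, v, w.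
have blue_K4 (u v w z : G) : color_rel c false u v -> color_rel c false u w ->
    color_rel c false u z -> color_rel c false v w -> color_rel c false v z ->
    color_rel c false w z -> False.
  by move=> uv uw uz vw vz wz; apply: no_blue; apply/has_copy4P; exists u, v, w, z.
have red_blue (u v : G) : color_rel c true u v -> ~~ color_rel c false u v.
  by rewrite /color_rel => /andP[-> /eqP->].
have pal : palette_colorable (color_rel c true) (color_rel c false) N Y.
  (* The red neighbourhood of [x] in the given colouring is a first valid red side. *)
  apply: (@extends_palette_colorable G _ _ (@color_sym _ _ _) (@color_sym _ _ _)
    (@color_irr _ _ _) (@color_irr _ _ _) red_blue red_tf blue_K4 N Y x6 _ _
    [set v | color_rel c true x v]).
  - by apply/set0Pn; exists y0.
  - move=> R y exR /YP[xy nxy].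
    exact: (recolor_extends_hit no_red no_blue xy nxy (addG x y xy nxy)).
  apply/and3P; split.
  - by apply/subsetP => v; rewrite !inE => /andP[].
  - apply/red_freeP => u v; rewrite !inE => xu xv; apply/negP; exact: red_tf xu xv.
  have xB u : u \in N :\: [set v | color_rel c true x v] -> color_rel c false x u.
    by rewrite !inE -(color_relE c x u) => /andP[/negPf->].
  apply/blue_triangle_freeP => u v w /xB xu /xB xv /xB xw uv uw vw.
  exact: blue_K4 xu xv xw uv uw vw.
have [f fE] := palette_coloring8 x6 y0Y pal.
have [xy nxy] := YP y0 y0Y.
by case: (@colorable8_not_arrows (add_edge x y0) f fE (addG x y0 xy nxy)).
Qed.

Lemma co_critical_min_degree (G : sgraph) :
  9 <= #|G| -> co_critical 'K_3 'K_4 G -> 7 <= min_degree G.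
Proof.
move=> G9 cG; rewrite /min_degree; elim/big_rec: _ => [|x m _ m7].
  (* The initial value [#|G|] of the minimum is at least 9. *)
  exact: leq_trans G9.
by rewrite leq_min co_critical_degree.
Qed.

(** * Sharpness *)

Section Ramsey.

Variables (T : finType) (e : rel T).
Hypotheses (eC : symmetric e) (e_irr : irreflexive e).

(** Ordering vertices by [enum_rank], each edge is counted once from its lower and once from its
    upper end. *)
Lemma handshake : ~~ odd (\sum_x #|[set y | e x y]|).
Proof.
pose lt (x y : T) := enum_rank x < enum_rank y.
have -> : \sum_x #|[set y | e x y]| =
    \sum_x \sum_(y | e x y && lt x y) 1 + \sum_x \sum_(y | e x y && lt y x) 1.
  rewrite -big_split; apply: eq_bigr => x _ /=.
  rewrite -sum1_card (bigID (lt x)) /=; congr addn; apply: eq_bigl => y; rewrite !inE //.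
  case exy: (e x y) => //=; rewrite /lt -leqNgt leq_eqVlt (inj_eq val_inj).
  by rewrite (inj_eq enum_rank_inj); case: eqP exy => // ->; rewrite e_irr.
have -> : \sum_x \sum_(y | e x y && lt y x) 1 = \sum_x \sum_(y | e x y && lt x y) 1.
  rewrite (exchange_big_dep predT) //=; apply: eq_bigr => x _.
  by apply: eq_bigl => y; rewrite eC.
by rewrite addnn odd_double.
Qed.

Hypothesis no_triangle : forall a b c, e a b -> e a c -> e b c -> False.

(** This is R(3,3) <= 6. A vertex [a] of [A] has three neighbours in [A], which are independent, or
    three non-neighbours, two of which are nonadjacent and form an independent triple with [a]. *)
Lemma independent3 (A : {set T}) : 6 <= #|A| ->
  exists a b c, [/\ a \in A, b \in A & c \in A] /\
    [/\ uniq [:: a; b; c], ~~ e a b, ~~ e a c & ~~ e b c].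
Proof.
move=> A6; have /card_gt0P[a aA] : 0 < #|A| by apply: leq_trans A6.
have split_A : #|A :\ a| = #|[set b in A | e a b]| + #|[set b in A :\ a | ~~ e a b]|.
  rewrite -(cardsID [set b | e a b] (A :\ a)); congr addn; apply: eq_card => b.
    by rewrite !inE; case: eqP => [->|]; rewrite ?e_irr ?andbF.
  by rewrite !inE andbC.
have A5 : 5 <= #|A :\ a| by move: A6; rewrite (cardsD1 a A) aA.
have [/card_geqP[s [us ss sS]]|lt3] := leqP 3 #|[set b in A | e a b]|.
  case: s us ss sS => [|b [|c [|d []]]] // us _ sS.
  have /andP[bA ab] : (b \in A) && e a b by move: (sS b); rewrite !inE eqxx; apply.
  have /andP[cA ac] : (c \in A) && e a c by move: (sS c); rewrite !inE eqxx orbT; apply.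
  have /andP[dA ad] : (d \in A) && e a d by move: (sS d); rewrite !inE eqxx !orbT; apply.
  exists b, c, d; split=> //; split=> //; apply/negP.
  - exact: no_triangle ab ac.
  - exact: no_triangle ab ad.
  exact: no_triangle ac ad.
have /card_geqP[s [us ss sS]] : 3 <= #|[set b in A :\ a | ~~ e a b]|.
  rewrite leqNgt; apply/negP => lt3'; move: A5; rewrite split_A leqNgt => /negP; apply.
  by rewrite ltnS; apply: (@leq_add _ _ 2 2).
case: s us ss sS => [|b [|c [|d []]]] // us _ sS.
have /and3P[ba bA ab] : [&& b != a, b \in A & ~~ e a b].
  by move: (sS b); rewrite !inE eqxx -andbA; apply.
have /and3P[ca cA ac] : [&& c != a, c \in A & ~~ e a c].
  by move: (sS c); rewrite !inE eqxx orbT -andbA; apply.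
have /and3P[da dA ad] : [&& d != a, d \in A & ~~ e a d].
  by move: (sS d); rewrite !inE eqxx !orbT -andbA; apply.
move: us; rewrite /= !inE !negb_or => /andP[/andP[bc bd] /andP[cd _]].
have [nbc|nbc] := boolP (e b c); last first.
  by exists a, b, c; split=> //; split; rewrite //= !inE !negb_or !(eq_sym a) ba ca bc.
have [nbd|nbd] := boolP (e b d); last first.
  by exists a, b, d; split=> //; split; rewrite //= !inE !negb_or !(eq_sym a) ba da bd.
exists a, c, d; split=> //; split; rewrite //= ?inE ?negb_or ?(eq_sym a) ?ca ?da ?cd //.
by apply/negP; apply: no_triangle nbc nbd.
Qed.

Hypothesis no_independent4 : forall a b c d, uniq [:: a; b; c; d] ->
  [|| e a b, e a c, e a d, e b c, e b d | e c d].

(* Degrees are at most 3 and numbers of non-neighbours at most 5, so on 9 vertices the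
   graph would be 3-regular of odd order. *)
Lemma ramsey34 : #|T| <> 9.
Proof.
move=> T9; have deg3 x : #|[set y | e x y]| = 3.
  have nbr : #|[set y | e x y]| <= 3.
    rewrite leqNgt; apply/negP => /card_geqP[s [us ss sS]].
    case: s us ss sS => [|a [|b [|c [|d []]]]] // us _ sS.
    have xs z : z \in [:: a; b; c; d] -> e x z by move=> /sS; rewrite inE.
    have ne z t : z \in [:: a; b; c; d] -> t \in [:: a; b; c; d] -> e z t = false.
      by move=> /xs xz /xs xt; apply/negP; apply: no_triangle xz xt.
    by have := no_independent4 us; rewrite !ne // !inE eqxx ?orbT.
  have nonnbr : #|[set y | ~~ e x y] :\ x| <= 5.
    rewrite leqNgt; apply/negP => /independent3[a [b [c [[]]]]].
    rewrite !inE => /andP[ax xa] /andP[bx xb] /andP[cx xc] [us ab ac bc].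
    have := @no_independent4 x a b c; rewrite cons_uniq us andbT !inE !negb_or !(eq_sym x).
    rewrite ax bx cx (negPf xa) (negPf xb) (negPf xc) (negPf ab) (negPf ac) (negPf bc).
    by move/(_ isT).
  have : #|T| = #|[set y | e x y]| + #|[set y | ~~ e x y] :\ x|.+1.
    rewrite -(cardsC [set y | e x y]); congr addn.
    rewrite (cardsD1 x) !inE e_irr /= add1n; congr S; apply: eq_card => y; by rewrite !inE.
  rewrite T9 addnS => -[] E; apply/eqP; rewrite eqn_leq nbr /=.
  by rewrite -(leq_add2r 5) [3 + 5]E leq_add2l.
have := handshake; rewrite (eq_bigr (fun => 3)) => [|x _]; last exact: deg3.
by rewrite sum_nat_const T9.
Qed.

End Ramsey.

Lemma clique9_arrows (G : sgraph) (g : 'I_9 -> G) : injective g ->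
  (forall i j, i != j -> g i -- g j) -> arrows G 'K_3 'K_4.
Proof.
move=> g_inj gE c.
have [|no_red] := has_copy3_dec (color_graph c true); first by left.
have [|no_blue] := has_copy4_dec (color_graph c false); first by right.
pose e (i j : 'I_9) := color_rel c true (g i) (g j).
case: (@ramsey34 _ e); last by rewrite card_ord.
- by move=> i j; apply: color_sym.
- by move=> i; apply: color_irr.
- by move=> i j k ij ik jk; case: no_red; apply/has_copy3P; exists (g i), (g j), (g k).
move=> i j k l /=; rewrite !inE !negb_or.
move=> /and4P[/and3P[ij ik il] /andP[jk jl] kl _]; apply/negPn/negP => no_e.
case: no_blue; apply/has_copy4P; exists (g i), (g j), (g k), (g l).
have blueE (a b : 'I_9) : a != b -> ~~ e a b -> color_rel c false (g a) (g b).
  by move=> ab; rewrite /e /color_rel gE //= eqb_id eqbF_neg.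
by move: no_e; rewrite !negb_or => /and5P[? ? ? ? /andP[? ?]]; split; split; apply: blueE.
Qed.

(** * The join of a 7-clique with an independent set *)

Definition join7_rel (n : nat) : rel 'I_n :=
  fun i j => (i != j) && ((i < 7) || (j < 7)).

Lemma join7_sym n : symmetric (@join7_rel n).
Proof. by move=> i j; rewrite /join7_rel eq_sym orbC. Qed.

Lemma join7_irr n : irreflexive (@join7_rel n).
Proof. by move=> i; rewrite /join7_rel eqxx. Qed.

Definition join7 (n : nat) : sgraph := SGraph (@join7_sym n) (@join7_irr n).

Lemma join7_nonadjacent n (x y : join7 n) : x != y -> ~~ (x -- y) -> 7 <= x /\ 7 <= y.
Proof. by move=> xy; rewrite /= /join7_rel xy negb_or -!leqNgt => /andP[]. Qed.

Lemma join7_co_critical n : 9 <= n -> co_critical 'K_3 'K_4 (join7 n).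
Proof.
move=> n9; split.
- have n7 : 7 < n by apply: leq_trans n9.
  (* The vertices 7 and 8 are nonadjacent. *)
  by move=> /(_ (Ordinal n7) (Ordinal n9) isT).
(* The clique keeps its numbers as colours and the whole independent set receives colour 7. *)
- apply: (@colorable8_not_arrows (join7 n) (fun i : 'I_n => inord (minn i 7))) => i j.
  rewrite /= /join7_rel => /andP[ij lt7]; apply: contra ij => /eqP/(congr1 val).
  rewrite /= !inordK ?ltnS ?geq_minr // => E; apply/eqP/val_inj => /=.
  move: lt7 E; rewrite /minn; case: (ltnP i 7) => i7; case: (ltnP j 7) => j7 //= _ E.
    by rewrite E in i7.
  by rewrite -E in j7.
move=> x y xy nxy; have [x7 y7] := join7_nonadjacent xy nxy.
(* The nine vertices of the clique: the seven universal ones, then [x] and [y]. *)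
pose m (i : 'I_9) := if i < 7 then i : nat else if i == 7 :> nat then x : nat else y : nat.
have mn i : m i < n by rewrite /m; case: ifP => // i7; [apply: leq_trans n9; apply: leq_trans i7 _|case: ifP].
pose g i : add_edge x y := Ordinal (mn i).
have m7 (i : 'I_9) : m i < 7 -> m i = i.
  by rewrite /m; case: (ltnP i 7) => // i7; case: ifP => _; rewrite ltnNge ?x7 ?y7.
have ge7 (i : 'I_9) : ~~ (m i < 7) -> 7 <= i.
  by rewrite /m; case: (ltnP i 7) => // ->.
have top (i : 'I_9) : 7 <= i -> (i = 7 :> nat /\ g i = x) \/ (i = 8 :> nat /\ g i = y).
  move=> i7; have mi : m i = if i == 7 :> nat then x : nat else y by rewrite /m ltnNge i7.
  case: (i =P 7 :> nat) mi => [E mi|ne mi].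
    by left; split=> //; apply: val_inj.
  right; split; last exact: val_inj.
  by apply/eqP; rewrite eqn_leq -ltnS ltn_ord /= ltn_neqAle i7 eq_sym andbT; apply/eqP.
have gE i j : i != j -> g i -- g j.
  move=> ij; have [|/norP[/ge7 i7 /ge7 j7]] := boolP ((m i < 7) || (m j < 7)).
    move=> lt7; rewrite /= /add_edge_rel /= /join7_rel /= lt7 andbT -val_eqE /=.
    apply/orP; left; apply: contra ij => /eqP E; apply/eqP/val_inj => /=.
    by case/orP: lt7 => /[dup] /m7 ?; [rewrite E|rewrite -E] => /m7 ?; congruence.
  have nyx : y != x by rewrite eq_sym.
  have ne a b : a = b :> nat -> i = a :> nat -> j = b :> nat -> False.
    by move=> ab ia jb; case/eqP: ij; apply: val_inj; rewrite /= ia jb.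
  rewrite /= /add_edge_rel.
  case: (top i i7) (top j j7) => [[i' ->]|[i' ->]] [[j' ->]|[j' ->]].
  - by case: (ne 7 7).
  - by rewrite xy eqxx orbT.
  - by rewrite nyx setUC eqxx orbT.
  by case: (ne 8 8).
apply: (@clique9_arrows (add_edge x y) g) => // i j gij.
by apply/eqP/negPn/negP => /gE; rewrite gij sedge_irr.
Qed.

Lemma min_degree_le (G : sgraph) (x : G) : min_degree G <= degree x.
Proof.
rewrite /min_degree; elim: (index_enum G) (mem_index_enum x) => // y s IH.
rewrite inE big_cons geq_min => /orP[/eqP->|/IH->]; by rewrite ?leqnn ?orbT.
Qed.

Lemma join7_min_degree n : 9 <= n -> min_degree (join7 n) = 7.
Proof.
(* The lower bound is the general one; the upper bound comes from vertex 7, whose neighbours are the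
   seven smaller vertices. *)
move=> n9; apply/eqP; rewrite eqn_leq co_critical_min_degree ?card_ord //; last exact: join7_co_critical.
have n7 : 7 < n by apply: leq_trans n9.
rewrite andbT (leq_trans (@min_degree_le (join7 n) (Ordinal n7))) //.
have -> : degree (Ordinal n7 : join7 n) = #|[set widen_ord (ltnW n7) i | i : 'I_7]|.
  apply: eq_card => j; rewrite !inE /= /join7_rel -val_eqE /=.
  apply/andP/imsetP => [[_ j7]|[i _ ->]] /=.
    by exists (Ordinal j7) => //; apply: val_inj.
  by rewrite ltn_ord neq_ltn ltn_ord orbT.
by rewrite (leq_trans (leq_imset_card _ _)) // card_ord.
Qed.

Theorem theorem1p9 :
  (forall (n : nat) (G : sgraph),
     9 <= n -> #|G| = n -> co_critical 'K_3 'K_4 G -> 7 <= min_degree G) /\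
  (forall n : nat, 9 <= n ->
     exists G : sgraph,
       [/\ #|G| = n, co_critical 'K_3 'K_4 G & min_degree G = 7]).
Proof.
split=> [n G n9 Gn|n n9]; first by rewrite -Gn in n9; apply: co_critical_min_degree.
exists (join7 n); split; first by rewrite card_ord.
  exact: join7_co_critical.
exact: join7_min_degree.
Qed.
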